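(* Let $R$ be a basic quasi-Frobenius algebra over an algebraically closed field $K$ with complete set of orthogonal primitive idempotents $\{e_1,\dots,e_m\}$, Nakayama permutation $\sigma$ and quiver $Q$; let $\varphi:KQ\to R$ be the surjective homomorphism described in the context, and let $\rho_1,\dots,\rho_w$ be basic elements of $KQ$ generating the two-sided ideal $\mathrm{Ker}\,\varphi$. Let $n_1,\dots,n_m\ge1$, let $P=R(n_1,\dots,n_m)$ be the block extension and $Q'$ its quiver. For each $1\le i\le m$ let $1\le c_{i1}\le c_{i2}\le\cdots\le c_{in_i}\le n_{\sigma(i)}$ be a sequence of natural numbers, and let $\overline P=P/X$ be the corresponding upper staircase factor algebra. For each $1\le i\le m$ let $\theta_i$ be a path of length $\ge1$ in $Q$ from $i$ to $\sigma(i)$ with $0\ne\varphi(\theta_i)\in S(e_iR)$. Then, with the numbers $u_i,l_{ij}$ and the elements $\theta'_i(u,v)\in KQ'$ defined in the context, there is a $K$-algebra isomorphism $$\overline P\simeq KQ'/I',$$ where $I'$ is the two-sided ideal $$I'=(e(\rho_1),\dots,e(\rho_w))+\big(\theta'_i(l_{ij},c_{i\,l_{ij}})\ \big|\ 1\le i\le m,\ 1\le j\le u_i,\ c_{i\,l_{ij}}\le n_{\sigma(i)}-1\big)$$ of $KQ'$ and $e:KQ_+\to KQ'_+$ is the extension map.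
   Context: Algebras are finite dimensional associative unital algebras over an algebraically closed field $K$ (path algebras excepted); modules are right modules; $J(-)$ denotes the Jacobson radical and $S(M)$ the socle of a module $M$. $R$ is basic if the modules $e_iR$ are pairwise non-isomorphic; quasi-Frobenius (QF) means self-injective. The Nakayama permutation $\sigma$ of $\{1,\dots,m\}$ is defined by $S(e_iR)\simeq e_{\sigma(i)}R/e_{\sigma(i)}J(R)$. Put $Q_i=A_{ii}=e_iRe_i$ and $A_{ij}=e_iRe_j$ for $i\ne j$. Put $X_{ii}=J(Q_i)^2+\sum_{k\ne i}A_{ik}A_{ki}$ and, for $i\neq j$, $X_{ij}=J(Q_i)A_{ij}+A_{ij}J(Q_j)+\sum_{k\ne i,j}A_{ik}A_{kj}$. Put $d_{ii}=\dim_K J(Q_i)/X_{ii}$ and $d_{ij}=\dim_K A_{ij}/X_{ij}$ for $i\ne j$. The quiver $Q$ of $R$ has vertices $1,\dots,m$ and $d_{ij}$ arrows $\alpha^1_{ij},\dots,\alpha^{d_{ij}}_{ij}$ from $i$ to $j$. Path algebras: $KQ$ has as basis all paths (including trivial ones); the product $pq$ of paths is the concatenation ''first $p$, then $q$'' if $p$ ends where $q$ starts, and $0$ otherwise. $KQ_+$ (resp. $KQ'_+$) is the span of all paths of length $\ge 1$. An element of $KQ$ is basic if all paths appearing in it have the same source and the same target. Fix elements $x^1_{ij},\dots,x^{d_{ij}}_{ij}$ of $J(Q_i)$ (if $i=j$) or of $A_{ij}$ (if $i\ne j$) whose classes form a $K$-basis of $J(Q_i)/X_{ii}$, resp. $A_{ij}/X_{ij}$.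 The surjective homomorphism $\varphi:KQ\to R$ sends the trivial path at $i$ to $e_i$ and $\alpha^t_{ij}$ to $x^t_{ij}\in e_iRe_j$. Block extension: for $1\le i,s\le m$, $1\le j\le n_i$, $1\le t\le n_s$ put $P_{ij,st}=Q_i$ if $i=s$ and $j\le t$; $P_{ij,st}=J(Q_i)$ if $i=s$ and $j>t$; $P_{ij,st}=A_{is}$ if $i\ne s$. The block extension $P=R(n_1,\dots,n_m)$ is the algebra of all matrices with rows and columns indexed by the pairs $(i,j)$, $1\le i\le m$, $1\le j\le n_i$, whose $(ij,st)$-entry lies in $P_{ij,st}$, with the usual matrix multiplication. Upper staircase factor algebra: given the sequences $(c_{ij})$, let $X\subset P$ be the set of matrices whose $(ij,st)$-entry is $0$ if $s\ne\sigma(i)$, is $0$ if $s=\sigma(i)$ and $t\le c_{ij}$, and lies in $S(A_{i\sigma(i)})$ if $s=\sigma(i)$ and $c_{ij}<t\le n_{\sigma(i)}$; here $S(A_{i\sigma(i)})$ is the socle of $A_{i\sigma(i)}$ as a right $Q_{\sigma(i)}$-module (it is simple as a left $Q_i$-module and as a right $Q_{\sigma(i)}$-module). $X$ is an ideal of $P$, and $\overline P=P/X$. Quiver $Q'$ of $P$: its vertices are the pairs $(i,j)$ with $1\le i\le m$, $1\le j\le n_i$; its arrows are one arrow $\delta_{ij}:(i,j)\to(i,j+1)$ for each $1\le i\le m$, $1\le j\le n_i-1$, and $d_{is}$ arrows $\beta^1_{is},\dots,\beta^{d_{is}}_{is}$ from $(i,n_i)$ to $(s,1)$ for each $1\le i,s\le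 m$. Extension map: put $\delta_i=\delta_{i1}\delta_{i2}\cdots\delta_{i,n_i-1}\in KQ'$ (the trivial path at $(i,1)$ if $n_i=1$). The extension map $e:KQ_+\to KQ'_+$ is the $K$-linear map sending a path $p=\alpha^{t_1}_{i_1i_2}\alpha^{t_2}_{i_2i_3}\cdots\alpha^{t_k}_{i_ki_{k+1}}$ ($k\ge1$) to $e(p)=\beta^{t_1}_{i_1i_2}\delta_{i_2}\beta^{t_2}_{i_2i_3}\delta_{i_3}\cdots\delta_{i_k}\beta^{t_k}_{i_ki_{k+1}}$. (One has $\mathrm{Ker}\,\varphi\subset KQ_+$, so $e(\rho_i)$ is defined.) The numbers $l_{ij}$: for each $i$, the integers $0=l_{i0}<l_{i1}<\cdots<l_{iu_i}=n_i$ are determined by $c_{i,l_{i,j-1}+1}=\cdots=c_{i,l_{ij}}$ for $1\le j\le u_i$ and $c_{i,l_{ij}}<c_{i,l_{ij}+1}$ for $1\le j\le u_i-1$ (so the $l_{ij}$ are the last indices of the maximal constant runs of $c_{i1},\dots,c_{in_i}$). The elements $\theta'_i(u,v)$: for $1\le v\le n_{\sigma(i)}-1$ put $\theta'_i(u,v)=\delta_{iu}\cdots\delta_{i,n_i-1}\,e(\theta_i)\,\delta_{\sigma(i)1}\cdots\delta_{\sigma(i)v}$ if $1\le u\le n_i-1$, and $\theta'_i(n_i,v)=e(\theta_i)\,\delta_{\sigma(i)1}\cdots\delta_{\sigma(i)v}$. *)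

(* Defs.v *)
From HB Require Import structures.
From mathcomp Require Import all_boot all_order all_fingroup all_algebra all_field.
From mathcomp Require Import generic_quotient finmap boolp monalg.

Set Implicit Arguments.
Unset Strict Implicit.
Unset Printing Implicit Defensive.

Import GRing.Theory.

Local Open Scope ring_scope.
Local Open Scope quotient_scope.

Section VspaceOf.
Variables (K : fieldType) (V : vectType K).

(* The subspace whose elements are the v with S v; it is only meaningful when
   S is closed under linear combinations (junk value 0 otherwise). *)
Definition vspace_of (S : V -> Prop) : {vspace V} :=
  if pselect (exists U : {vspace V}, forall v, v \in U <-> S v) is left h
  then projT1 (cid h) else 0%VS.

Lemma vspace_ofP (S : V -> Prop) :
    S 0 -> (forall a u v, S u -> S v -> S (a *: u + v)) ->
  forall v, v \in vspace_of S <-> S v.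
Proof.
move=> S0 Slin; rewrite /vspace_of; case: pselect => [h|[]].
  exact: (projT2 (cid h)).
pose P n := `[< exists U : {vspace V}, \dim U = n /\ forall v, v \in U -> S v >].
have exP : exists n, P n.
  exists 0%N; apply/asboolP; exists 0%VS; rewrite dimv0; split=> // v.
  by rewrite memv0 => /eqP ->.
have ubP n : P n -> (n <= \dim {:V})%N.
  by move=> /asboolP[U [<- _]]; apply/dimvS/subvf.
case: (ex_maxnP exP ubP) => n /asboolP[U [dU SU]] maxn.
exists U => v; split=> [/SU//|Sv].
have SUv w : w \in (U + <[v]>)%VS -> S w.
  case/memv_addP=> u uU [_ /vlineP[a ->] ->].
  by rewrite addrC; apply: Slin => //; apply: SU.
have le : (\dim (U + <[v]>) <= \dim U)%N.
  by rewrite dU; apply: maxn; apply/asboolP; exists (U + <[v]>)%VS.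
have /eqP -> : U == (U + <[v]>)%VS by rewrite eqEdim addvSl.
by rewrite (subvP (addvSr _ _)) // memv_line.
Qed.

End VspaceOf.

(* Modules are right modules inside a finite dimensional algebra R: A is R or a
   corner e R e (e idempotent), and an A-module is a subspace M of R on which
   the unit of A acts as the identity, with M A <= M. *)

Section Modules.
Variables (K : fieldType) (R : falgType K).
Implicit Types A M U V : {vspace R}.

Definition submodule A M U : bool := (U <= M)%VS && (U * A <= U)%VS.

Definition simple_module A M : Prop :=
  [/\ (M * A <= M)%VS, M <> 0%VS
    & forall U, submodule A M U -> U = 0%VS \/ U = M].

Definition in_socle A M (x : R) : Prop :=
  exists s : seq {vspace R},
    (forall U, U \in s -> submodule A M U /\ simple_module A U)
    /\ x \in (\sum_(U <- s) U)%VS.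

Definition socle A M : {vspace R} := vspace_of (in_socle A M).

Lemma socleP A M x : x \in socle A M <-> in_socle A M x.
Proof.
apply: vspace_ofP => [|a u v [s [hs us]] [t [ht vt]]].
  by exists [::]; split=> //; rewrite big_nil mem0v.
exists (s ++ t); split=> [U|].
  by rewrite mem_cat => /orP[/hs|/ht].
by rewrite big_cat /= memv_add // memvZ.
Qed.

Definition maximal_right_ideal A U : Prop :=
  [/\ submodule A A U, U <> A
    & forall V, submodule A A V -> (U <= V)%VS -> V = U \/ V = A].

Definition in_jacobson A (x : R) : Prop :=
  x \in A /\ forall U, maximal_right_ideal A U -> x \in U.

Definition jacobson A : {vspace R} := vspace_of (in_jacobson A).

Lemma jacobsonP A x : x \in jacobson A <-> in_jacobson A x.
Proof.
apply: vspace_ofP => [|a u v [uA hu] [vA hv]].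
  by split=> [|U _]; rewrite mem0v.
by split=> [|U mU]; rewrite memvD ?memvZ //; [apply: hu | apply: hv].
Qed.

(* The right A-modules U / U' and V / V' are isomorphic (for submodules
   U' <= U and V' <= V): f is a K-linear lift to R of an isomorphism
   U / U' -> V / V'; a module homomorphism is automatically K-linear. *)
Definition subquotient_iso A U U' V V' : Prop :=
  exists f : 'End(R),
    [/\ (f @: U <= V)%VS,
        forall u a, u \in U -> a \in A -> f (u * a) - f u * a \in V',
        forall u, u \in U -> (f u \in V') = (u \in U')
      & (V <= f @: U + V')%VS].

Definition module_iso A U V : Prop := subquotient_iso A U 0 V 0.

End Modules.

(* Right R-modules are left modules over the converse ring R^c, and R^c^o is
   R viewed as a right module over itself. *)
Definition quasi_frobenius (R : pzRingType) : Prop :=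
  forall (M N : lmodType R^c) (f : {linear M -> N}) (g : {linear M -> R^c^o}),
    injective f -> exists h : {linear N -> R^c^o}, forall x, h (f x) = g x.

Section Peirce.
Variables (K : fieldType) (R : falgType K) (m : nat).
Implicit Types (e : 'I_m -> R) (i j k : 'I_m).

Definition primitive_idempotent (f : R) : Prop :=
  [/\ f != 0, f * f = f
    & forall g h : R, g * g = g -> h * h = h -> g * h = 0 -> h * g = 0 ->
        f = g + h -> g = 0 \/ h = 0].

Definition complete_primitive_orthogonal e : Prop :=
  [/\ forall i, primitive_idempotent (e i),
      forall i j, i != j -> e i * e j = 0
    & \sum_i e i = 1].

Definition right_proj e i : {vspace R} := (<[e i]> * {:R})%VS.

Definition basic_algebra e : Prop :=
  forall i j, i != j -> ~ module_iso {:R} (right_proj e i) (right_proj e j).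

Definition peirce e i j : {vspace R} := (<[e i]> * {:R} * <[e j]>)%VS.

Definition corner_rad e i : {vspace R} := jacobson (peirce e i i).

Definition arrow_space e i j : {vspace R} :=
  if i == j then corner_rad e i else peirce e i j.

Definition decomposable e i j : {vspace R} :=
  if i == j
  then (corner_rad e i * corner_rad e i
        + \sum_(k | k != i) peirce e i k * peirce e k i)%VS
  else (corner_rad e i * peirce e i j + peirce e i j * corner_rad e j
        + \sum_(k | (k != i) && (k != j)) peirce e i k * peirce e k j)%VS.

(* As e is basic, decomposable e i j <= arrow_space e i j, so this is the
   dimension of the quotient. *)
Definition arrow_num e i j : nat :=
  \dim (arrow_space e i j) - \dim (decomposable e i j).

Definition basis_mod_decomposable e i j (x : 'I_(arrow_num e i j) -> R) : Prop :=
  (forall t, x t \in arrow_space e i j) /\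
  forall y, y \in arrow_space e i j ->
    exists! a : {ffun 'I_(arrow_num e i j) -> K},
      y - \sum_t a t *: x t \in decomposable e i j.

Definition nakayama_permutation e (sigma : {perm 'I_m}) : Prop :=
  forall i, subquotient_iso {:R} (socle {:R} (right_proj e i)) 0
              (right_proj e (sigma i))
              (<[e (sigma i)]> * jacobson {:R})%VS.

Variable e : 'I_m -> R.
Hypothesis he : complete_primitive_orthogonal e.

Lemma idem_mul i : e i * e i = e i.
Proof. by case: he => /(_ i)[]. Qed.

Lemma peirceE i j x : (x \in peirce e i j) <-> e i * x = x /\ x * e j = x.
Proof.
split=> [|[<- <-]]; last by rewrite !memv_mul ?memvf ?memv_line.
case/memv_cosetP=> u hu ->; split; last by rewrite -mulrA idem_mul.
suff /subvP/(_ u hu) : (<[e i]> * {:R} <= lker (amull (e i) - \1)%VF)%VS.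
  rewrite memv_ker add_lfunE opp_lfunE id_lfunE lfunE /= subr_eq0 => /eqP eu.
  by rewrite mulrA eu.
apply/prodvP=> _ v /vlineP[a ->] _.
rewrite memv_ker add_lfunE opp_lfunE id_lfunE lfunE /= subr_eq0.
by rewrite -!scalerAl -scalerAr mulrA idem_mul.
Qed.

Lemma peirce_id i : e i \in peirce e i i.
Proof. by apply/peirceE; rewrite idem_mul. Qed.

Lemma peirceM i j k x y :
  x \in peirce e i j -> y \in peirce e j k -> x * y \in peirce e i k.
Proof.
by move=> /peirceE[ex _] /peirceE[_ ye]; apply/peirceE; rewrite mulrA ex -mulrA ye.
Qed.

Lemma peirce_idem i f : f \in peirce e i i -> f * f = f -> f = 0 \/ f = e i.
Proof.
move=> /peirceE[ef fe] ff; case: he => /(_ i)[_ ee prim] _ _.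
have [] // := prim f (e i - f).
- by rewrite mulrBr !mulrBl ee ef fe ff subrr subr0.
- by rewrite mulrBr fe ff subrr.
- by rewrite mulrBl ef ff subrr.
- by rewrite addrC subrK.
- by left.
by move/eqP; rewrite subr_eq0 => /eqP ->; right.
Qed.

Lemma peirce_fitting i u : u \in peirce e i i ->
  (exists n, u ^+ n.+1 = 0) \/
  (exists2 v, v \in peirce e i i & u * v = e i).
Proof.
move=> hu; have [eu ue] := (peirceE i i u).1 hu.
pose W n := ('C[u] * <[u ^+ n.+1]>)%VS.
have exP : exists d, `[< exists n, \dim (W n) = d >].
  by exists (\dim (W 0%N)); apply/asboolP; exists 0%N.
case: (ex_minnP exP) => d /asboolP[n dn] min_d.
have W2 : (W (n + n.+1)%N <= W n)%VS.
  apply/subvP=> _ /memv_cosetP[q hq ->]; apply/memv_cosetP.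
  exists (q * u ^+ n.+1); last by rewrite -mulrA -exprD addSn.
  by apply/cent1vP; rewrite -mulrA -exprSr exprS mulrA (cent1vP hq) mulrA.
have /memv_cosetP[q /cent1vP hq uq] : u ^+ n.+1 \in W (n + n.+1)%N.
  have /eqP -> : W (n + n.+1)%N == W n.
    by rewrite eqEdim W2 dn; apply: min_d; apply/asboolP; exists (n + n.+1)%N.
  by apply/memv_cosetP; exists 1; rewrite ?mul1r // cent1v1.
have eX (k : nat) : e i * u ^+ k.+1 = u ^+ k.+1 by rewrite exprS mulrA eu.
have Xe (k : nat) : u ^+ k.+1 * e i = u ^+ k.+1 by rewrite exprSr -mulrA ue.
pose r := e i * q * e i.
have ru : r * u = u * r.
  by rewrite /r -!mulrA eu hq !mulrA eu ue -hq -mulrA ue.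
have hr : r \in peirce e i i.
  by apply/peirceE; rewrite /r !mulrA idem_mul -!mulrA idem_mul.
have cX (k : nat) : GRing.comm r (u ^+ k) by apply: commrX.
have ur : u ^+ n.+1 = r * u ^+ n.+1 * u ^+ n.+1.
  have -> : r * u ^+ n.+1 * u ^+ n.+1 = e i * q * (e i * u ^+ n.+1) * u ^+ n.+1.
    by rewrite /r !mulrA.
  by rewrite eX -mulrA -exprD -mulrA addSn -uq eX.
clearbody r.
have hX (k : nat) : u ^+ k.+1 \in peirce e i i by apply/peirceE; rewrite eX Xe.
case: (@peirce_idem i (r * u ^+ n.+1)).
- exact: peirceM hr (hX n).
- by rewrite -mulrA (mulrA (u ^+ _)) -cX -ur.
- by move=> r0; left; exists n; rewrite ur r0 mul0r.
move=> re; right; exists (e i * u ^+ n * r).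
  apply/peirceE; rewrite !mulrA idem_mul; split=> //.
  by rewrite -!mulrA ((peirceE i i r).1 hr).2.
by rewrite !mulrA ue -exprS -cX re.
Qed.

Lemma corner_radP i x : x \in corner_rad e i <->
  x \in peirce e i i /\ forall y, y \in peirce e i i -> x * y <> e i.
Proof.
rewrite /corner_rad; split=> [/jacobsonP[hx Ux]|[hx nx]].
  split=> // y hy xy.
  pose Q := peirce e i i.
  pose P d := `[< exists U, [/\ submodule Q Q U, U <> Q & \dim U = d] >].
  have e0 : e i != 0 by case: he => /(_ i)[].
  have exP : exists d, P d.
    exists 0%N; apply/asboolP; exists 0%VS; rewrite dimv0; split=> //.
      by rewrite /submodule sub0v prod0v sub0v.
    move=> Q0; move: (peirce_id i); rewrite -/Q -Q0 memv0 => /eqP e0'.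
    by rewrite e0' eqxx in e0.
  have ubP d : P d -> (d <= \dim {:R})%N.
    by move=> /asboolP[U [_ _ <-]]; apply/dimvS/subvf.
  case: (ex_maxnP exP ubP) => d /asboolP[U [sU nU dU]] max_d.
  have mU : maximal_right_ideal Q U.
    split=> // V sV UV; case: (eqVneq V Q) => [->|/eqP nV]; first by right.
    left; apply/eqP; rewrite eq_sym eqEdim UV dU; apply: max_d.
    by apply/asboolP; exists V.
  have /andP[UQ UM] := sU; case: nU; apply/eqP; rewrite eqEsubv UQ /=.
  have eU : e i \in U by rewrite -xy (subvP UM) // memv_mul // Ux.
  apply/subvP=> z hz; have [<- _] := (peirceE i i z).1 hz.
  by rewrite (subvP UM) // memv_mul.
apply/jacobsonP; split=> // U [/andP[UQ UM] nU maxU].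
case: (boolP (x \in U)) => // xU; exfalso.
pose Q := peirce e i i.
have hQQ : (Q * Q <= Q)%VS by apply/prodvP=> a b; apply: peirceM.
have sV : submodule Q Q (U + <[x]> * Q)%VS.
  rewrite /submodule prodvDl; apply/andP; split.
    rewrite subv_add UQ; apply/prodvP=> _ b /vlineP[a ->] hb.
    by rewrite -scalerAl memvZ // (peirceM hx).
  by rewrite addvS // -prodvA prodvSr.
case: (maxU _ sV (addvSl _ _)) => [VU|VQ].
  case/negP: xU; rewrite -VU (subvP (addvSr _ _)) //.
  by rewrite -{1}((peirceE i i x).1 hx).2 memv_mul ?memv_line ?peirce_id.
have eQ : e i \in (U + <[x]> * Q)%VS by rewrite VQ peirce_id.
case/memv_addP: eQ => u uU [w hw eE].
have [q hq wE] : exists2 q, q \in Q & w = x * q.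
  have : w \in (amull x @: Q)%VS.
    apply: subvP hw; apply/prodvP=> _ b /vlineP[a ->] hb.
    have -> : a *: x * b = amull x (a *: b) by rewrite lfunE /= -scalerAl -scalerAr.
    by rewrite memv_img // memvZ.
  by case/memv_imgP=> q hq ->; exists q; rewrite // lfunE.
have uQ : u \in peirce e i i := subvP UQ _ uU.
case: (peirce_fitting uQ) => [[n un]|[v hv uv]].
  pose s := \sum_(k < n.+1) u ^+ k.
  have es : (1 - u) * s = 1.
    have := subrX1 u n.+1; rewrite un sub0r -(opprB 1 u) mulNr => /oppr_inj.
    by move=> <-.
  have := nx (q * (e i * s * e i)).
  apply; first apply: peirceM hq _.
    by apply/peirceE; rewrite !mulrA idem_mul -!mulrA idem_mul.
  rewrite mulrA -wE.
  have -> : w = e i - u by rewrite eE addrC addKr.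
  have [eu ue] := (peirceE i i u).1 uQ.
  have -> : (e i - u) * (e i * s * e i) = e i * ((1 - u) * s) * e i.
    by rewrite !mulrA mulrBl idem_mul ue mulrBr mulr1 eu.
  by rewrite es mulr1 idem_mul.
apply: nU; apply/eqP; rewrite eqEsubv UQ; apply/subvP=> z hz.
have [<- _] := (peirceE i i z).1 hz.
by rewrite (subvP UM) // memv_mul // -uv (subvP UM) // memv_mul.
Qed.

Lemma corner_rad_sub i : (corner_rad e i <= peirce e i i)%VS.
Proof. by apply/subvP=> x /corner_radP[]. Qed.

Lemma corner_radMr i x y :
  x \in corner_rad e i -> y \in peirce e i i -> x * y \in corner_rad e i.
Proof.
move=> /corner_radP[hx nx] hy; apply/corner_radP; split; first exact: peirceM hy.
by move=> z hz; rewrite -mulrA; apply: nx; apply: peirceM hz.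
Qed.

Lemma corner_radMl i x y :
  x \in peirce e i i -> y \in corner_rad e i -> x * y \in corner_rad e i.
Proof.
move=> hx /corner_radP[hy ny]; apply/corner_radP; split; first exact: peirceM hy.
move=> z hz xyz; have e0 : e i != 0 by case: he => /(_ i)[].
have hyz := peirceM hy hz.
case: (@peirce_idem i (y * z * x)); first exact: peirceM hx.
- have -> : y * z * x * (y * z * x) = y * z * (x * y * z) * x by rewrite !mulrA.
  by rewrite xyz ((peirceE i i _).1 hyz).2.
- move=> yzx; case/eqP: e0; rewrite -idem_mul -xyz.
  have -> : x * y * z * (x * y * z) = x * (y * z * x) * (y * z) by rewrite !mulrA.
  by rewrite yzx mulr0 mul0r.
by rewrite -mulrA; apply: ny; apply: peirceM hx.
Qed.

Lemma corner_radM i k x y : basic_algebra e -> i != k ->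
  x \in peirce e i k -> y \in peirce e k i -> x * y \in corner_rad e i.
Proof.
move=> hb ik hx hy; apply/corner_radP; split; first exact: peirceM hy.
move=> z hz xyz; have e0 : e i != 0 by case: he => /(_ i)[].
have hyz := peirceM hy hz; set w := y * z in hyz.
have xw : x * w = e i by rewrite /w mulrA.
have wx : w * x = e k.
  case: (@peirce_idem k (w * x)) => //; first exact: peirceM hx.
    have -> : w * x * (w * x) = w * (x * w) * x by rewrite !mulrA.
    by rewrite xw ((peirceE _ _ _).1 hyz).2.
  move=> wx0; case/eqP: e0; rewrite -idem_mul -xw.
  have -> : x * w * (x * w) = x * (w * x) * w by rewrite !mulrA.
  by rewrite wx0 mulr0 mul0r.
have [ew we] := (peirceE _ _ _).1 hyz; have [ex xe] := (peirceE _ _ _).1 hx.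
have proj j u : u \in right_proj e j -> e j * u = u.
  move=> hu; suff /subvP/(_ u hu) : (right_proj e j <= lker (amull (e j) - \1)%VF)%VS.
    rewrite memv_ker add_lfunE opp_lfunE id_lfunE lfunE /= subr_eq0 => /eqP//.
  apply/prodvP=> _ v /vlineP[a ->] _.
  rewrite memv_ker add_lfunE opp_lfunE id_lfunE lfunE /= subr_eq0.
  by rewrite -!scalerAl -scalerAr mulrA idem_mul.
apply: (hb i k ik); exists (amull w); split.
- apply/subvP=> _ /memv_imgP[u hu ->]; rewrite lfunE /= -ew -mulrA.
  by rewrite memv_mul ?memv_line ?memvf.
- by move=> u a _ _; rewrite !lfunE /= mulrA subrr mem0v.
- move=> u hu; rewrite lfunE /= !memv0; apply/eqP/eqP=> [wu|->]; last exact: mulr0.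
  by rewrite -(proj i u hu) -xw -mulrA wu mulr0.
apply/subvP=> u hu; rewrite addv0 -(proj k u hu) -wx -mulrA.
have -> : w * (x * u) = amull w (x * u) by rewrite lfunE.
by rewrite memv_img // -ex -mulrA memv_mul ?memv_line ?memvf.
Qed.

End Peirce.

Section Ideals.
Variables (K : pzRingType) (A : algType K).
Implicit Types (I J S : A -> Prop) (x y : A).

Definition two_sided_ideal I : Prop :=
  [/\ I 0, forall x y, I x -> I y -> I (x + y)
    & forall a x b, I x -> I (a * x * b)].

Definition ideal_gen S x : Prop :=
  forall I, two_sided_ideal I -> (forall y, S y -> I y) -> I x.

Definition ideal_sum I J x : Prop :=
  exists y z, [/\ I y, J z & x = y + z].

Lemma ideal_gen_ideal S : two_sided_ideal (ideal_gen S).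
Proof.
split=> [I [] //|x y Sx Sy I hI SI|a x b Sx I hI SI]; have [_ ID IM] := hI.
  by apply: ID; [apply: Sx | apply: Sy].
by apply: IM; apply: Sx.
Qed.

Lemma ideal_gen_id S : two_sided_ideal S -> forall x, ideal_gen S x <-> S x.
Proof. by move=> hS x; split=> [|Sx I _]; [apply | apply]. Qed.

Lemma ideal_sum_ideal I J :
  two_sided_ideal I -> two_sided_ideal J -> two_sided_ideal (ideal_sum I J).
Proof.
move=> [I0 ID IM] [J0 JD JM]; split.
- by exists 0, 0; split; rewrite ?addr0.
- move=> _ _ [y [z [Iy Jz ->]]] [y' [z' [Iy' Jz' ->]]].
  by exists (y + y'), (z + z'); rewrite addrACA; split; [apply: ID|apply: JD|].
move=> a _ b [y [z [Iy Jz ->]]]; exists (a * y * b), (a * z * b).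
by rewrite mulrDr mulrDl; split; [apply: IM|apply: JM|].
Qed.

End Ideals.

(* The quotient of A by the two-sided ideal generated by S; by ideal_gen_id
   this is A / S as soon as S is an ideal.  It is a ring and a K-module; it may
   be zero, whereas the library's algType requires 1 != 0. *)
Section Quotient.
Variables (K : pzRingType) (A : algType K) (S : A -> Prop).
Implicit Types x y z : A.
Let I := ideal_gen S.

Let I0 : I 0. Proof. by case: (ideal_gen_ideal S). Qed.
Let ID x y : I x -> I y -> I (x + y).
Proof. by case: (ideal_gen_ideal S) => _ h _; apply: h. Qed.
Let IMl a x : I x -> I (a * x).
Proof.
by case: (ideal_gen_ideal S) => _ _ h Ix; rewrite -[_ * _]mulr1; apply: h.
Qed.
Let IMr x b : I x -> I (x * b).
Proof. by case: (ideal_gen_ideal S) => _ _ h Ix; rewrite -[x]mul1r; apply: h. Qed.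
Let IN x : I x -> I (- x).
Proof. by move=> Ix; rewrite -mulN1r; apply: IMl. Qed.
Let IZ a x : I x -> I (a *: x).
Proof. by move=> Ix; rewrite -[x]mul1r scalerAl; apply: IMl. Qed.

Definition ideal_equiv x y : bool := `[< ideal_gen S (x - y) >].

Lemma ideal_equiv_is_equiv : equiv_class_of ideal_equiv.
Proof.
split=> [x|x y|y x z].
- by apply/asboolP; rewrite subrr.
- by apply/asboolP/asboolP=> /IN; rewrite opprB.
move=> /asboolP xy /asboolP yz; apply/asboolP.
by rewrite -[x](subrK y) -addrA; apply: ID.
Qed.

Canonical ideal_equiv_equiv := EquivRelPack ideal_equiv_is_equiv.
Canonical ideal_equiv_encModRel := defaultEncModRel ideal_equiv.

Definition quotient := {eq_quot ideal_equiv}.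

HB.instance Definition _ : EqQuotient A ideal_equiv quotient :=
  EqQuotient.on quotient.
HB.instance Definition _ := Choice.on quotient.

Lemma quotientP x y : \pi_quotient x = \pi_quotient y <-> ideal_gen S (x - y).
Proof.
split=> [/eqP|h]; first by rewrite piE => /asboolP.
by apply/eqP; rewrite piE; apply/asboolP.
Qed.

Let repr_pi x : I (repr (\pi_quotient x) - x).
Proof. by apply/quotientP; rewrite reprK. Qed.

Definition quotient_zero : quotient := lift_cst quotient 0.
Definition quotient_one : quotient := lift_cst quotient 1.
Definition quotient_opp := lift_op1 quotient -%R.
Definition quotient_add := lift_op2 quotient +%R.
Definition quotient_mul := lift_op2 quotient *%R.
Definition quotient_scale (a : K) (u : quotient) : quotient :=
  \pi_quotient (a *: repr u).

Canonical pi_quotient_zero := PiConst quotient_zero.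
Canonical pi_quotient_one := PiConst quotient_one.

Lemma pi_quotient_oppE : {morph \pi : x / - x >-> quotient_opp x}.
Proof.
move=> x; unlock quotient_opp; apply/quotientP.
by rewrite opprK addrC; apply: repr_pi.
Qed.
Canonical pi_quotient_opp := PiMorph1 pi_quotient_oppE.

Lemma pi_quotient_addE : {morph \pi : x y / x + y >-> quotient_add x y}.
Proof.
move=> x y; unlock quotient_add; apply/esym/quotientP.
by rewrite opprD addrACA; apply: ID; apply: repr_pi.
Qed.
Canonical pi_quotient_add := PiMorph2 pi_quotient_addE.

Lemma pi_quotient_mulE : {morph \pi : x y / x * y >-> quotient_mul x y}.
Proof.
move=> x y; unlock quotient_mul; apply/esym/quotientP.
set x' := repr _; set y' := repr _.
rewrite -(subrK (x' * y) (x' * y')) -mulrBr -addrA -mulrBl.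
by apply: ID; [apply: IMl | apply: IMr]; apply: repr_pi.
Qed.
Canonical pi_quotient_mul := PiMorph2 pi_quotient_mulE.

Lemma pi_quotient_scaleE a x :
  quotient_scale a (\pi_quotient x) = \pi_quotient (a *: x).
Proof. by apply/quotientP; rewrite -scalerBr; apply: IZ; apply: repr_pi. Qed.

Let addqA : associative quotient_add.
Proof. by move=> x y z; rewrite -[x]reprK -[y]reprK -[z]reprK !piE addrA. Qed.
Let addqC : commutative quotient_add.
Proof. by move=> x y; rewrite -[x]reprK -[y]reprK !piE addrC. Qed.
Let add0q : left_id quotient_zero quotient_add.
Proof. by move=> x; rewrite -[x]reprK !piE add0r. Qed.
Let addNq : left_inverse quotient_zero quotient_opp quotient_add.
Proof. by move=> x; rewrite -[x]reprK !piE addNr. Qed.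

HB.instance Definition _ := GRing.isZmodule.Build quotient addqA addqC add0q addNq.

Let mulqA : associative quotient_mul.
Proof. by move=> x y z; rewrite -[x]reprK -[y]reprK -[z]reprK !piE mulrA. Qed.
Let mul1q : left_id quotient_one quotient_mul.
Proof. by move=> x; rewrite -[x]reprK !piE mul1r. Qed.
Let mulq1 : right_id quotient_one quotient_mul.
Proof. by move=> x; rewrite -[x]reprK !piE mulr1. Qed.

Lemma pi_quotientD x y : \pi_quotient (x + y) = \pi_quotient x + \pi_quotient y.
Proof. exact: pi_quotient_addE. Qed.

Let mulqDl : left_distributive quotient_mul +%R.
Proof.
move=> x y z; rewrite -[x]reprK -[y]reprK -[z]reprK -pi_quotientD !piE.
by rewrite mulrDl pi_quotientD.
Qed.
Let mulqDr : right_distributive quotient_mul +%R.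
Proof.
move=> x y z; rewrite -[x]reprK -[y]reprK -[z]reprK -pi_quotientD !piE.
by rewrite mulrDr pi_quotientD.
Qed.

HB.instance Definition _ :=
  GRing.Zmodule_isPzRing.Build quotient mulqA mul1q mulq1 mulqDl mulqDr.

Lemma pi_quotientM x y : \pi_quotient (x * y) = \pi_quotient x * \pi_quotient y.
Proof. exact: pi_quotient_mulE. Qed.

Let scaleqA a b u :
  quotient_scale a (quotient_scale b u) = quotient_scale (a * b) u.
Proof.
rewrite -[u]reprK (pi_quotient_scaleE b (repr u)).
by rewrite 2!pi_quotient_scaleE scalerA. Qed.
Let scale1q : left_id 1 quotient_scale.
Proof. by move=> u; rewrite -[u]reprK pi_quotient_scaleE scale1r. Qed.
Let scaleqDr : right_distributive quotient_scale +%R.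
Proof.
move=> a u v; rewrite -[u]reprK -[v]reprK -pi_quotientD !pi_quotient_scaleE.
by rewrite scalerDr pi_quotientD.
Qed.
Let scaleqDl u : {morph quotient_scale^~ u : a b / a + b}.
Proof.
by move=> a b; rewrite -[u]reprK !pi_quotient_scaleE scalerDl pi_quotientD.
Qed.

HB.instance Definition _ :=
  GRing.Zmodule_isLmodule.Build K quotient scaleqA scale1q scaleqDr scaleqDl.

Lemma pi_quotientZ a x : \pi_quotient (a *: x) = a *: \pi_quotient x.
Proof. by rewrite -[RHS]/(quotient_scale _ _) pi_quotient_scaleE. Qed.

End Quotient.

Definition quotients_isomorphic (K : pzRingType) (A B : algType K)
    (S : A -> Prop) (T : B -> Prop) : Prop :=
  exists2 f : {rmorphism quotient S -> quotient T}, scalable f & bijective f.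

Record quiver := Quiver {
  vertex : finType;
  arrow : finType;
  source : arrow -> vertex;
  target : arrow -> vertex;
  vertex_gt0 : (0 < #|vertex|)%N
}.

Section Paths.
Variable Q : quiver.
Implicit Types (v : vertex Q) (a : arrow Q) (s t : seq (arrow Q)).

Fixpoint walk v s : bool :=
  if s is a :: s' then (source a == v) && walk (target a) s' else true.

Definition walk_end v s : vertex Q := last v (map (@target Q) s).

Lemma walk_cat v s t : walk v (s ++ t) = walk v s && walk (walk_end v s) t.
Proof. by elim: s v => //= a s IHs v; rewrite IHs andbA. Qed.

Lemma walk_end_cat v s t : walk_end v (s ++ t) = walk_end (walk_end v s) t.
Proof. by rewrite /walk_end map_cat last_cat. Qed.

(* A path is its source together with the sequence of its arrows in order. *)
Record qpath := QPath {
  qpath_val : vertex Q * seq (arrow Q);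
  _ : walk qpath_val.1 qpath_val.2
}.

HB.instance Definition _ := [isSub for qpath_val].
HB.instance Definition _ := [Choice of qpath by <:].

Implicit Types p q r : qpath.

Definition psource p : vertex Q := (val p).1.
Definition parrows p : seq (arrow Q) := (val p).2.
Definition ptarget p : vertex Q := walk_end (psource p) (parrows p).
Definition plength p : nat := size (parrows p).

Definition trivial_path v : qpath := @QPath (v, [::]) isT.

Lemma arrow_path_subproof a : walk (source a) [:: a].
Proof. by rewrite /= eqxx. Qed.
Definition arrow_path a : qpath := @QPath (source a, [:: a]) (arrow_path_subproof a).

Definition pconcat p q : option qpath :=
  if ptarget p == psource q then insub (psource p, parrows p ++ parrows q)
  else None.

Lemma pconcat_ok p q : ptarget p = psource q ->
  exists r, [/\ pconcat p q = Some r, psource r = psource p,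
               parrows r = parrows p ++ parrows q & ptarget r = ptarget q].
Proof.
move=> pq; have w : walk (psource p) (parrows p ++ parrows q).
  by rewrite walk_cat (valP p) -/(ptarget p) pq (valP q).
exists (@QPath (psource p, parrows p ++ parrows q) w); split=> //.
  by rewrite /pconcat pq eqxx insubT.
by rewrite /ptarget [parrows _]/= [psource _]/= walk_end_cat -/(ptarget p) pq.
Qed.

Lemma qpath_eq p q : psource p = psource q -> parrows p = parrows q -> p = q.
Proof.
by case: p q => [[v s] w] [[v' s'] w']; rewrite /psource /parrows /= => ev es;
  apply: val_inj; rewrite /= ev es.
Qed.

Lemma pconcatA p q r :
  obind (pconcat p) (pconcat q r) = obind (pconcat^~ r) (pconcat p q).
Proof.
have [pq|npq] := eqVneq (ptarget p) (psource q); last first.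
  have -> : pconcat p q = None by rewrite /pconcat (negbTE npq).
  have [qr|nqr] := eqVneq (ptarget q) (psource r); last first.
    by have -> : pconcat q r = None by rewrite /pconcat (negbTE nqr).
  by have [x [-> sx _ _]] := pconcat_ok qr; rewrite /= /pconcat sx (negbTE npq).
have [y [-> sy ay ty]] := pconcat_ok pq.
have [qr|nqr] := eqVneq (ptarget q) (psource r); last first.
  have -> : pconcat q r = None by rewrite /pconcat (negbTE nqr).
  by rewrite /= /pconcat ty (negbTE nqr).
have [x [-> sx ax _]] := pconcat_ok qr => /=.
have px : ptarget p = psource x by rewrite sx.
have yr : ptarget y = psource r by rewrite ty.
have [z [-> sz az _]] := pconcat_ok px; have [w [-> sw aw _]] := pconcat_ok yr.
by congr Some; apply: qpath_eq; rewrite ?sz ?az ?sw ?aw ?sy ?ay ?ax ?catA.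
Qed.

Lemma pconcat_trivl v p :
  pconcat (trivial_path v) p = if v == psource p then Some p else None.
Proof.
have [vp|nvp] := eqVneq v (psource p); last by rewrite /pconcat (negbTE nvp).
have [q [-> sq aq _]] := @pconcat_ok (trivial_path v) p vp.
by congr Some; apply: qpath_eq; rewrite ?sq ?aq.
Qed.

Lemma pconcat_trivr v p :
  pconcat p (trivial_path v) = if v == ptarget p then Some p else None.
Proof.
rewrite eq_sym; have [pv|npv] := eqVneq (ptarget p) v; last first.
  by rewrite /pconcat (negbTE npv).
have [q [-> sq aq _]] := @pconcat_ok p (trivial_path v) pv.
by congr Some; apply: qpath_eq; rewrite ?sq ?aq //= cats0.
Qed.

End Paths.

(* The K-vector space with basis the paths of Q; << p >> is the basis element p *)
Definition path_alg (K : fieldType) (Q : quiver) : Type := {malg K[qpath Q]}.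

Section PathAlgebra.
Variables (K : fieldType) (Q : quiver).
Implicit Types (p q r : qpath Q) (x y z : path_alg K Q).

HB.instance Definition _ := GRing.Lmodule.on (path_alg K Q).

Definition of_path p : path_alg K Q := << (1 : K) *g p >>.
Definition path_coef p x : K := mcoeff p x.
Definition path_supp x : {fset qpath Q} := msupp x.

Definition linear_ext (V : lmodType K) (f : qpath Q -> V) x : V :=
  \sum_(p <- path_supp x) path_coef p x *: f p.

Section LinearExt.
Variables (V : lmodType K) (f : qpath Q -> V).

Lemma linear_ext_wide (D : {fset qpath Q}) x : (path_supp x `<=` D)%fset ->
  linear_ext f x = \sum_(p <- D) path_coef p x *: f p.
Proof.

move=> sD; rewrite /linear_ext (big_fset_incl _ sD) // => p _ pn.
by rewrite /path_coef mcoeff_outdom // scale0r.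
Qed.

Lemma linear_ext_is_linear : linear (linear_ext f).
Proof.
move=> a x y.
pose z := a *: x + y; rewrite -/z.
pose D := (path_supp z `|` (path_supp x `|` path_supp y))%fset.
have Dz : (path_supp z `<=` D)%fset by apply: fsubsetUl.
have Dx : (path_supp x `<=` D)%fset.
  by apply: fsubset_trans (fsubsetUr _ _); apply: fsubsetUl.
have Dy : (path_supp y `<=` D)%fset.
  by apply: fsubset_trans (fsubsetUr _ _); apply: fsubsetUr.
rewrite (linear_ext_wide Dz) (linear_ext_wide Dx) (linear_ext_wide Dy) /z.
rewrite scaler_sumr -big_split /=; apply: eq_bigr => p _.
by rewrite /path_coef mcoeffD mcoeffZ scalerDl scalerA.
Qed.
HB.instance Definition _ :=
  GRing.isLinear.Build K (path_alg K Q) V _ (linear_ext f) linear_ext_is_linear.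

Lemma linear_ext_path p : linear_ext f (of_path p) = f p.
Proof.
by rewrite (linear_ext_wide msuppU_le) big_seq_fset1 /path_coef mcoeffUU scale1r.
Qed.

End LinearExt.

Lemma path_algE x : x = \sum_(p <- path_supp x) path_coef p x *: of_path p.
Proof.
rewrite [LHS]monalgE; apply: eq_bigr => p _; apply/malgP=> q.
by rewrite mcoeffZ !mcoeffU mulr_natr.
Qed.

Lemma path_alg_ext (V : lmodType K) (f g : {linear path_alg K Q -> V}) :
  (forall p, f (of_path p) = g (of_path p)) -> f =1 g.
Proof.
move=> fg x; rewrite [x]path_algE !linear_sum; apply: eq_bigr => p _.
by rewrite !linearZ /= fg.
Qed.

Definition path_mul p q : path_alg K Q := oapp of_path 0 (pconcat p q).

Definition path_alg_mul x y : path_alg K Q :=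
  linear_ext (fun p => linear_ext (path_mul p) y) x.

Definition path_alg_one : path_alg K Q := \sum_v of_path (trivial_path v).

Lemma path_alg_mulDl : left_distributive path_alg_mul +%R.
Proof. by move=> x y z; rewrite /path_alg_mul linearD. Qed.

Lemma path_alg_mulZl a x y : path_alg_mul (a *: x) y = a *: path_alg_mul x y.
Proof. by rewrite /path_alg_mul linearZ. Qed.

Lemma path_alg_mul_is_linear x : linear (path_alg_mul x).
Proof.
move=> a y z; rewrite /path_alg_mul /linear_ext scaler_sumr -big_split /=.
apply: eq_bigr => p _.
by rewrite -/(linear_ext _ _) linearP scalerDr !scalerA mulrC.
Qed.
HB.instance Definition _ x := GRing.isLinear.Build K _ _ _ (path_alg_mul x)
  (path_alg_mul_is_linear x).

Lemma path_alg_mulE p q : path_alg_mul (of_path p) (of_path q) = path_mul p q.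
Proof. by rewrite /path_alg_mul !linear_ext_path. Qed.

Definition path_alg_mulr y x := path_alg_mul x y.
Lemma path_alg_mulr_is_linear y : linear (path_alg_mulr y).
Proof.
by move=> a x z; rewrite /path_alg_mulr path_alg_mulDl path_alg_mulZl.
Qed.
HB.instance Definition _ y := GRing.isLinear.Build K _ _ _ (path_alg_mulr y)
  (path_alg_mulr_is_linear y).

Lemma path_alg_mul0x y : path_alg_mul 0 y = 0.
Proof. exact: (linear0 (path_alg_mulr y)). Qed.

Lemma path_alg_mulA : associative path_alg_mul.
Proof.
move=> x y z.
apply: (@path_alg_ext _ (path_alg_mulr (path_alg_mul y z))
  (path_alg_mulr z \o path_alg_mulr y)) => {x} p /=; rewrite /path_alg_mulr.
apply: (@path_alg_ext _ (path_alg_mul (of_path p) \o path_alg_mulr z)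
  (path_alg_mulr z \o path_alg_mul (of_path p))) => {y} q /=; rewrite /path_alg_mulr.
apply: (@path_alg_ext _ (path_alg_mul (of_path p) \o path_alg_mul (of_path q))
  (path_alg_mul (path_alg_mul (of_path p) (of_path q)))) => {z} r /=.
rewrite !path_alg_mulE; have := pconcatA p q r; rewrite /path_mul.
case: (pconcat q r) => [x|] /=; case: (pconcat p q) => [y|] /=.
- by rewrite !path_alg_mulE /path_mul => ->.
- by rewrite path_alg_mulE /path_mul => ->; rewrite path_alg_mul0x.
- by rewrite path_alg_mulE /path_mul => <-; rewrite linear0.
- by rewrite linear0 path_alg_mul0x.
Qed.

Lemma path_alg_mul1x : left_id path_alg_one path_alg_mul.
Proof.
move=> x; apply: (@path_alg_ext _ (path_alg_mul path_alg_one) idfun) => {x} p /=.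
rewrite -/(path_alg_mulr _ _) /path_alg_one linear_sum (bigD1 (psource p)) //=.
rewrite /path_alg_mulr path_alg_mulE /path_mul pconcat_trivl eqxx /= big1 ?addr0 //.
move=> v vp; rewrite -/(path_alg_mulr _ _) /path_alg_mulr path_alg_mulE.
by rewrite /path_mul pconcat_trivl (negbTE vp).
Qed.

Lemma path_alg_mulx1 : right_id path_alg_one path_alg_mul.
Proof.
move=> x; apply: (@path_alg_ext _ (path_alg_mulr path_alg_one) idfun) => {x} p /=.
rewrite /path_alg_mulr /path_alg_one linear_sum (bigD1 (ptarget p)) //=.
rewrite path_alg_mulE /path_mul pconcat_trivr eqxx /= big1 ?addr0 //.
by move=> v vp; rewrite path_alg_mulE /path_mul pconcat_trivr (negbTE vp).
Qed.

Lemma path_alg_one_neq0 : path_alg_one != 0.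
Proof.
have /card_gt0P[v _] := vertex_gt0 Q; apply/eqP.
move/(congr1 (mcoeff (trivial_path v))); apply/eqP.
rewrite raddf_sum mcoeff0 (bigD1 v) //= mcoeffUU big1 ?addr0 ?oner_eq0 //.
move=> w wv; rewrite mcoeffU; case: eqP => // /(congr1 (@psource Q)) /= /eqP.
by rewrite (negbTE wv).
Qed.

Lemma path_alg_mulDr : right_distributive path_alg_mul +%R.
Proof. by move=> x y z; rewrite linearD. Qed.

HB.instance Definition _ := GRing.Zmodule_isNzRing.Build (path_alg K Q)
  path_alg_mulA path_alg_mul1x path_alg_mulx1 path_alg_mulDl path_alg_mulDr
  path_alg_one_neq0.

Lemma path_alg_scalerAl a x y : a *: (x * y) = (a *: x) * y.
Proof. by rewrite -[RHS]/(path_alg_mul _ _) path_alg_mulZl. Qed.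

Lemma path_alg_scalerAr a x y : a *: (x * y) = x * (a *: y).
Proof. by rewrite -[RHS]/(path_alg_mul _ _) linearZ. Qed.

HB.instance Definition _ :=
  GRing.Lmodule_isLalgebra.Build K (path_alg K Q) path_alg_scalerAl.
HB.instance Definition _ :=
  GRing.Lalgebra_isAlgebra.Build K (path_alg K Q) path_alg_scalerAr.

Lemma of_pathM p q : of_path p * of_path q = oapp of_path 0 (pconcat p q).
Proof. exact: path_alg_mulE. Qed.

Definition vertex_elt v : path_alg K Q := of_path (trivial_path v).
Definition arrow_elt a : path_alg K Q := of_path (arrow_path a).

Definition basic_element x : Prop :=
  forall p q, p \in path_supp x -> q \in path_supp x ->
    psource p = psource q /\ ptarget p = ptarget q.

End PathAlgebra.

Section BlockExtension.
Variables (K : fieldType) (R : falgType K) (m : nat) (e : 'I_m -> R).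
Hypothesis he : complete_primitive_orthogonal e.

Lemma idem_num_gt0 : (0 < #|'I_m|)%N.
Proof.
rewrite card_ord; case: m e he => [|//] e' [_ _ /eqP].
by rewrite big_ord0 eq_sym oner_eq0.
Qed.

(* The arrow alpha^t_{ij} is Tagged _ t with tag (i, j). *)
Definition alg_arrow : finType :=
  {ij : 'I_m * 'I_m & 'I_(arrow_num e ij.1 ij.2)}.

Definition alg_quiver : quiver :=
  @Quiver 'I_m alg_arrow (fun a => (tag a).1) (fun a => (tag a).2) idem_num_gt0.

Definition mk_arrow i j (t : 'I_(arrow_num e i j)) : arrow alg_quiver :=
  @existT _ (fun ij : 'I_m * 'I_m => 'I_(arrow_num e ij.1 ij.2)) (i, j) t.

Variable n : 'I_m -> nat.
Hypothesis n_gt0 : forall i, (0 < n i)%N.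

(* The pair written (i, j) with 1 <= j <= n_i in the usual numbering is
   encoded with the ordinal j - 1 : 'I_(n i). *)
Definition block_index : finType := {i : 'I_m & 'I_(n i)}.
Definition mk_index i (j : 'I_(n i)) : block_index :=
  @existT _ (fun i => 'I_(n i)) i j.

Lemma last_index_subproof i : ((n i).-1 < n i)%N.
Proof. by rewrite ltn_predL n_gt0. Qed.
Definition first_index i : block_index := mk_index (Ordinal (n_gt0 i)).
Definition last_index i : block_index := mk_index (Ordinal (last_index_subproof i)).

Lemma block_index_gt0 : (0 < #|block_index|)%N.
Proof.
by have /card_gt0P[i _] := idem_num_gt0; apply/card_gt0P; exists (first_index i).
Qed.

Definition block_space (x y : block_index) : {vspace R} :=
  if tag x == tag y then
    if (tagged x <= tagged y)%N then peirce e (tag x) (tag x)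
    else corner_rad e (tag x)
  else peirce e (tag x) (tag y).

Definition block_pred : {pred {ffun block_index * block_index -> R}} :=
  fun M => [forall x, forall y, M (x, y) \in block_space x y].

Hypothesis hb : basic_algebra e.

Lemma block_spaceM x z y a b :
  a \in block_space x z -> b \in block_space z y -> a * b \in block_space x y.
Proof.
case: x z y => [i j] [k l] [s t]; rewrite /block_space /=.
have sub := subvP (corner_rad_sub he _).
have [ik|ik] := eqVneq i k.
  subst k; have [is_|is_] := eqVneq i s; last first.
    by case: ifP => _ ha; apply: (peirceM he) => //; apply: sub.
  subst s; case: (leqP j t) => [jt|tj].
    move=> ha hb'; apply: (peirceM he (j := i)).
      by move: ha; case: ifP => // _; apply: sub.
    by move: hb'; case: ifP => // _; apply: sub.
  case: (leqP j l) => [jl|lj] ha.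
    rewrite leqNgt (leq_trans tj jl) /= => hb'; exact: (corner_radMl he).
  case: ifP => _ hb'; apply: (corner_radMr he) => //; exact: sub.
have [ks|ks] := eqVneq k s.
  subst s; rewrite (negbTE ik) => ha hb'; apply: (peirceM he ha).
  by move: hb'; case: ifP => // _; apply: sub.
move=> ha hb'; have [is_|is_] := eqVneq i s; last exact: (peirceM he ha).
subst s; case: ifP => _; first exact: (peirceM he ha).
exact: (corner_radM he hb ik).
Qed.

Lemma block_space1 x : e (tag x) \in block_space x x.
Proof. by rewrite /block_space eqxx leqnn (peirce_id he). Qed.

Lemma block_space_id x y a :
  a \in block_space x y -> e (tag x) * a = a /\ a * e (tag y) = a.
Proof.
case: x y => [i j] [s t]; rewrite /block_space /= => ha; apply/(peirceE he).
move: ha; have [is_|//] := eqVneq i s; subst s.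
by case: ifP => // _; apply: (subvP (corner_rad_sub he _)).
Qed.

Lemma block_submod_closed : submod_closed block_pred.
Proof.
split=> [|a M N hM hN]; apply/forallP=> x; apply/forallP=> y.
  by rewrite ffunE mem0v.
by rewrite !ffunE memvD ?memvZ //; [move/forallP/(_ x)/forallP: hM
  | move/forallP/(_ x)/forallP: hN].
Qed.

HB.instance Definition _ :=
  GRing.isSubmodClosed.Build K {ffun block_index * block_index -> R} block_pred
    block_submod_closed.

Record block_matrix := BlockMatrix {
  block_mx :> {ffun block_index * block_index -> R};
  _ : block_mx \in block_pred
}.

HB.instance Definition _ := [isSub for block_mx].
HB.instance Definition _ := [Choice of block_matrix by <:].
HB.instance Definition _ := [SubChoice_isSubLmodule of block_matrix by <:].

Implicit Types M N L : block_matrix.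

Lemma block_mxP M x y : M (x, y) \in block_space x y.
Proof. by have /forallP/(_ x)/forallP := valP M. Qed.

Lemma block_one_subproof :
  [ffun xy => if xy.1 == xy.2 then e (tag xy.1) else 0] \in block_pred.
Proof.
apply/forallP=> x; apply/forallP=> y; rewrite ffunE /=.
by case: eqP => [<-|_]; [apply: block_space1 | apply: mem0v].
Qed.
Definition block_one : block_matrix := BlockMatrix block_one_subproof.

Lemma block_mul_subproof M N :
  [ffun xy => \sum_z M (xy.1, z) * N (z, xy.2)] \in block_pred.
Proof.
apply/forallP=> x; apply/forallP=> y; rewrite ffunE /=.
by apply: memv_suml => z _; apply: block_spaceM (block_mxP _ _ _) (block_mxP _ _ _).
Qed.
Definition block_mul M N : block_matrix := BlockMatrix (block_mul_subproof M N).

Lemma block_matrix_eq M N : (forall x y, M (x, y) = N (x, y)) -> M = N.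
Proof. by move=> MN; apply/val_inj/ffunP=> -[x y]; apply: MN. Qed.

Lemma block_mulE M N x y : block_mul M N (x, y) = \sum_z M (x, z) * N (z, y).
Proof. by rewrite ffunE. Qed.

Lemma block_addE M N x y : (M + N) (x, y) = M (x, y) + N (x, y).
Proof. by rewrite ffunE. Qed.

Lemma block_scaleE a M x y : (a *: M) (x, y) = a *: M (x, y).
Proof. by rewrite ffunE. Qed.

Let block_mulA : associative block_mul.
Proof.
move=> M N L; apply: block_matrix_eq => x y; rewrite !block_mulE.
under eq_bigr do rewrite block_mulE mulr_sumr.
rewrite exchange_big; apply: eq_bigr => z _; rewrite block_mulE mulr_suml.
by apply: eq_bigr => w _; rewrite mulrA.
Qed.

Let block_mul1 : left_id block_one block_mul.
Proof.
move=> M; apply: block_matrix_eq => x y; rewrite block_mulE (bigD1 x) //=.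
rewrite ffunE eqxx (block_space_id (block_mxP M x y)).1 big1 ?addr0 // => z zx.
by rewrite ffunE /= eq_sym (negbTE zx) mul0r.
Qed.

Let block_mulr1 : right_id block_one block_mul.
Proof.
move=> M; apply: block_matrix_eq => x y; rewrite block_mulE (bigD1 y) //=.
rewrite ffunE eqxx (block_space_id (block_mxP M x y)).2 big1 ?addr0 // => z zy.
by rewrite ffunE /= (negbTE zy) mulr0.
Qed.

Let block_mulDl : left_distributive block_mul +%R.
Proof.
move=> M N L; apply: block_matrix_eq => x y; rewrite block_addE !block_mulE -big_split.
by apply: eq_bigr => z _; rewrite block_addE mulrDl.
Qed.

Let block_mulDr : right_distributive block_mul +%R.
Proof.
move=> M N L; apply: block_matrix_eq => x y; rewrite block_addE !block_mulE -big_split.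
by apply: eq_bigr => z _; rewrite block_addE mulrDr.
Qed.

Let block_one_neq0 : block_one != 0.
Proof.
have /card_gt0P[x _] := block_index_gt0; apply/eqP=> /(congr1 (fun M => block_mx M (x, x))).
by apply/eqP; rewrite !ffunE eqxx; case: he => /(_ (tag x))[].
Qed.

(* The type depends on the hypotheses under which the matrices form an algebra. *)
Definition block_ext of complete_primitive_orthogonal e
  & (forall i, (0 < n i)%N) & basic_algebra e : Type := block_matrix.
Local Notation P := (block_ext he n_gt0 hb).

HB.instance Definition _ := GRing.Lmodule.on P.
HB.instance Definition _ := GRing.Zmodule_isNzRing.Build P
  block_mulA block_mul1 block_mulr1 block_mulDl block_mulDr block_one_neq0.

Lemma block_extM (M N : P) x y : (M * N) (x, y) = \sum_z M (x, z) * N (z, y).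
Proof. exact: block_mulE. Qed.

Let block_scaleAl a (M N : P) : a *: (M * N) = (a *: M) * N.
Proof.
apply: block_matrix_eq => x y; rewrite block_scaleE !block_mulE scaler_sumr.
by apply: eq_bigr => z _; rewrite block_scaleE scalerAl.
Qed.
Let block_scaleAr a (M N : P) : a *: (M * N) = M * (a *: N).
Proof.
apply: block_matrix_eq => x y; rewrite block_scaleE !block_mulE scaler_sumr.
by apply: eq_bigr => z _; rewrite block_scaleE scalerAr.
Qed.

HB.instance Definition _ := GRing.Lmodule_isLalgebra.Build K P block_scaleAl.
HB.instance Definition _ := GRing.Lalgebra_isAlgebra.Build K P block_scaleAr.

(* The sequences (c_ij) are indexed from 1: c i j is c_ij for
   1 <= j <= n i, other values are irrelevant. *)
Definition staircase_space (sigma : 'I_m -> 'I_m) (c : 'I_m -> nat -> nat)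
    (x y : block_index) : {vspace R} :=
  if (tag y == sigma (tag x)) && (c (tag x) (tagged x).+1 < (tagged y).+1)%N
  then socle (peirce e (tag y) (tag y)) (peirce e (tag x) (tag y))
  else 0%VS.

Definition staircase sigma c (M : P) : Prop :=
  forall x y, M (x, y) \in staircase_space sigma c x y.

(* inl a, with a = Tagged _ j and tag a = i, is the arrow delta from the j-th
   to the next index of block i (numbered from 0); inr is for the beta's. *)
Definition block_arrow : finType := ({i : 'I_m & 'I_(n i).-1} + alg_arrow)%type.

Lemma delta_source_subproof i (j : 'I_(n i).-1) : (j < n i)%N.
Proof. exact: leq_trans (ltn_ord j) (leq_pred _). Qed.
Lemma delta_target_subproof i (j : 'I_(n i).-1) : (j.+1 < n i)%N.
Proof. by have := ltn_ord j; rewrite ltn_predRL. Qed.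

Definition block_source (a : block_arrow) : block_index :=
  match a with
  | inl d => mk_index (Ordinal (delta_source_subproof (tagged d)))
  | inr b => last_index (tag b).1
  end.

Definition block_target (a : block_arrow) : block_index :=
  match a with
  | inl d => mk_index (Ordinal (delta_target_subproof (tagged d)))
  | inr b => first_index (tag b).2
  end.

Definition block_quiver : quiver := Quiver block_source block_target block_index_gt0.

Local Notation KQ := (path_alg K alg_quiver).
Local Notation KQ' := (path_alg K block_quiver).

Definition delta i (j : 'I_(n i).-1) : KQ' :=
  @arrow_elt K block_quiver (inl (Tagged (fun i => 'I_(n i).-1) j)).

Definition beta (a : arrow alg_quiver) : KQ' := @arrow_elt K block_quiver (inr a).

Definition delta_full i : KQ' :=
  @vertex_elt K block_quiver (first_index i) * \prod_j @delta i j.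

Fixpoint ext_arrows (s : seq (arrow alg_quiver)) : KQ' :=
  match s with
  | [::] => 0
  | [:: a] => beta a
  | a :: s' => beta a * delta_full (target a) * ext_arrows s'
  end.

(* Only its restriction to the span KQ_+ of the paths of length >= 1 matters;
   trivial paths are sent to 0. *)
Definition extension_map : KQ -> KQ' :=
  linear_ext (fun p : qpath alg_quiver => ext_arrows (parrows p)).

(* theta'_i(u, v), with u and v numbered from 1; for u = n i the first product
   is empty. *)
Definition theta' (sigma : 'I_m -> 'I_m) (theta : 'I_m -> qpath alg_quiver)
    (i : 'I_m) (u v : nat) : KQ' :=
  \prod_(j < (n i).-1 | (u <= j.+1)%N) @delta i j
  * extension_map (of_path K (theta i))
  * \prod_(k < (n (sigma i)).-1 | (k < v)%N) @delta (sigma i) k.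

End BlockExtension.

(* The last indices l i 1 < ... < l i (u i) = n i of the maximal constant runs
   of c i 1, ..., c i (n i); by convention l i 0 = 0. *)
Definition run_ends m (n : 'I_m -> nat) (c : 'I_m -> nat -> nat)
    (u : 'I_m -> nat) (l : 'I_m -> nat -> nat) : Prop :=
  forall i,
    [/\ l i 0%N = 0%N /\ l i (u i) = n i,
        forall j, (j < u i)%N -> (l i j < l i j.+1)%N,
        forall j k, (1 <= j <= u i)%N -> (l i j.-1 < k <= l i j)%N ->
          c i k = c i (l i j)
      & forall j, (1 <= j <= (u i).-1)%N -> (c i (l i j) < c i (l i j).+1)%N].

(* Main.v *)
Require Import Defs.
From HB Require Import structures.
From mathcomp Require Import all_boot all_order all_fingroup all_algebra all_field.
From mathcomp Require Import generic_quotient boolp.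

Set Implicit Arguments.
Unset Strict Implicit.
Unset Printing Implicit Defensive.

Import GRing.Theory.

Local Open Scope ring_scope.
Local Open Scope quotient_scope.

(** Every path of the quiver Q' from x = (i, j) to y = (s, t) becomes, once its
    arrows delta are erased, a path of Q from i to s; call it its collapse.
    Conversely a nontrivial path p from i to s comes from exactly one path from
    x to y, namely delta_ij .. delta_i(n_i - 1) e(p) delta_s1 .. delta_s(t - 1),
    and the trivial path at i comes from a path inside the block i exactly when
    j <= t.  So KQ' is the block extension of KQ in all but name, and sending a
    path p' to the matrix whose only nonzero entry, in row x and column y, is
    phi of its collapse defines an algebra morphism Psi = block_map from KQ' to P.

    Psi is onto because an element of e_i R e_s is phi of a combination of paths,
    and because a radical element of e_i R e_i is phi of a combination of
    nontrivial ones: nontrivial closed paths have radical images, and e_i is not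
    in the radical.

    The kernel of Psi is (e(rho_1), .., e(rho_w)).  If Psi b = 0, the component of
    b from x to y collapses to some a in Ker phi, whose trivial part vanishes for
    the same reason, hence that component is delta .. e(a) delta ..; and e maps
    Ker phi into the ideal of the e(rho_k), since e(p a) = e(p) delta e(a) for
    a nontrivial path p and every a in Ker phi.

    It remains to see that Psi maps the ideal of the theta'_i(l_ij, c_il_ij)
    onto X.  The socle of e_i R is K phi(theta_i): it is isomorphic to the top
    of e_(sigma i) R, which is one-dimensional.  Since e_i R has no other simple
    submodule, K phi(theta_i) is also the socle of A_(i, sigma i) over the corner
    Q_(sigma i).  Hence X is spanned by the images of the theta'_i(u, v) with
    c_iu <= v, and each of these is a multiple of theta'_i(l, c_il), where l is
    the last index of the run of c_i that contains u. *)

(** * Two-sided ideals and quotients *)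

Section IdealFacts.
Variables (K : pzRingType) (A : algType K) (I : A -> Prop).
Hypothesis hI : two_sided_ideal I.

Lemma ideal_zero : I 0. Proof. by case: hI. Qed.
Lemma ideal_add x y : I x -> I y -> I (x + y).
Proof. by case: hI => _ h _; apply: h. Qed.
Lemma ideal_mull a x : I x -> I (a * x).
Proof. by case: hI => _ _ h Ix; rewrite -[_ * _]mulr1; apply: h. Qed.
Lemma ideal_mulr x a : I x -> I (x * a).
Proof. by case: hI => _ _ h Ix; rewrite -[x]mul1r; apply: h. Qed.
Lemma ideal_scale a x : I x -> I (a *: x).
Proof. by move=> Ix; rewrite -[x]mul1r scalerAl; apply: ideal_mull. Qed.
Lemma ideal_bigsum (T : Type) (r : seq T) (P : pred T) (F : T -> A) :
  (forall i, P i -> I (F i)) -> I (\sum_(i <- r | P i) F i).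
Proof. by move=> h; elim/big_ind: _ => //; [exact: ideal_zero | exact: ideal_add]. Qed.

End IdealFacts.

Section FirstIsomorphism.
Variables (K : pzRingType) (A B : algType K) (g : {linear B -> A}).
Hypotheses (g1 : g 1 = 1) (gM : forall a b, g (a * b) = g a * g b).
Hypothesis g_surj : forall a, exists b, g b = a.
Variables (S : A -> Prop) (T : B -> Prop).
Hypothesis hT : two_sided_ideal T.
Hypothesis ST : forall b, T b <-> ideal_gen S (g b).

Definition lift_quotient (q : Defs.quotient S) : Defs.quotient T :=
  \pi_(Defs.quotient T) (projT1 (cid (g_surj (repr q)))).

Lemma lift_quotient_pi b :
  lift_quotient (\pi_(Defs.quotient S) (g b)) = \pi_(Defs.quotient T) b.
Proof.
rewrite /lift_quotient; case: cid => b' /= gb'; apply/quotientP.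
apply/(ideal_gen_id hT)/ST; rewrite linearB /= gb'.
by apply/quotientP; rewrite reprK.
Qed.

Lemma quotient_surj q : exists b, q = \pi_(Defs.quotient S) (g b).
Proof. by have [b gb] := g_surj (repr q); exists b; rewrite gb reprK. Qed.

Lemma lift_quotient_is_zmod_morphism : zmod_morphism lift_quotient.
Proof.
move=> q q'; have [b ->] := quotient_surj q; have [b' ->] := quotient_surj q'.
rewrite !lift_quotient_pi -!scaleN1r -!pi_quotientZ -!pi_quotientD.
by rewrite -linearZ -linearD lift_quotient_pi.
Qed.

Lemma lift_quotient_is_monoid_morphism : monoid_morphism lift_quotient.
Proof.
split=> [|q q'].
  have -> : 1 = \pi_(Defs.quotient S) (g 1) by rewrite g1 piE.
  by rewrite lift_quotient_pi piE.
have [b ->] := quotient_surj q; have [b' ->] := quotient_surj q'.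
by rewrite -pi_quotientM -gM !lift_quotient_pi pi_quotientM.
Qed.

HB.instance Definition _ := GRing.isZmodMorphism.Build (Defs.quotient S) (Defs.quotient T)
  lift_quotient lift_quotient_is_zmod_morphism.
HB.instance Definition _ := GRing.isMonoidMorphism.Build (Defs.quotient S) (Defs.quotient T)
  lift_quotient lift_quotient_is_monoid_morphism.

(** The first isomorphism theorem, for a surjection that is only required to
    match the two ideals. *)
Lemma quotients_isomorphic_of_surjection : quotients_isomorphic S T.
Proof.
exists lift_quotient => [a q|].
  have [b ->] := quotient_surj q.
  have -> : a *: \pi_(Defs.quotient S) (g b) = \pi_(Defs.quotient S) (g (a *: b)).
    by rewrite linearZ pi_quotientZ.
  by rewrite /= 2!lift_quotient_pi pi_quotientZ.
exists (fun q => \pi_(Defs.quotient S) (g (repr q))) => q; last first.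
  by rewrite /= lift_quotient_pi reprK.
have [b ->] := quotient_surj q; rewrite /= lift_quotient_pi; apply/quotientP.
rewrite -linearB; apply/ST/(ideal_gen_id hT).
by apply/quotientP; rewrite reprK.
Qed.

End FirstIsomorphism.

(** * Radical and socle of a split basic algebra *)

Section Radical.
Variables (K : fieldType) (R : falgType K) (m : nat) (e : 'I_m -> R).
Hypotheses (he : complete_primitive_orthogonal e) (hb : basic_algebra e).
Implicit Types (U : {vspace R}) (i j k : 'I_m) (r z : R).

Lemma memv_lineMP (u : R) U v :
  v \in (<[u]> * U)%VS -> exists2 q, q \in U & v = u * q.
Proof.
move=> hv; have : v \in (amull u @: U)%VS.
  apply: subvP hv; apply/prodvP=> _ b /vlineP[a ->] hU.
  have -> : a *: u * b = amull u (a *: b) by rewrite lfunE /= -scalerAl -scalerAr.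
  by rewrite memv_img // memvZ.
by case/memv_imgP=> q hq ->; exists q; rewrite // lfunE.
Qed.

Lemma idemM i j : e i * e j = if i == j then e i else 0.
Proof.
by have [<-|ij] := eqVneq i j; [apply: (idem_mul he) | case: he => _ + _; apply].
Qed.

Lemma peirce_comp i j r : e i * r * e j \in peirce e i j.
Proof. by apply/(peirceE he); rewrite !mulrA idemM eqxx -!mulrA idemM eqxx. Qed.

Lemma sum_idem_r r : r = \sum_j r * e j.
Proof. by case: he => _ _ s1; rewrite -mulr_sumr s1 mulr1. Qed.

Lemma idem_notin_rad i : e i \notin corner_rad e i.
Proof.
by apply/negP=> /(corner_radP he)[ei] /(_ _ ei); rewrite (idem_mul he).
Qed.

(** A corner is local, so its radical elements are nilpotent: iterating
    z = z r reaches 0.  This replaces Nakayama's lemma below. *)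
Lemma corner_rad_fix0 j r z : r \in corner_rad e j -> z = z * r -> z = 0.
Proof.
move=> hr zr; have [hrr nr] := (corner_radP he j r).1 hr.
case: (peirce_fitting he hrr) => [[k rk]|[v hv /(nr v hv)//]].
have : forall k : nat, z = z * r ^+ k.
  by elim=> [|k' IH]; rewrite ?expr0 ?mulr1 // exprSr mulrA -IH.
by move/(_ k.+1); rewrite rk mulr0.
Qed.

(** The same nilpotency, used as the geometric series that inverts e_j - r in
    the corner. *)
Lemma idem_mem_of_sub_rad j r U :
  r \in corner_rad e j -> (U * {:R} <= U)%VS -> e j - r \in U -> e j \in U.
Proof.
move=> hr UR hU; have [hrr nr] := (corner_radP he j r).1 hr.
have [er re] := (peirceE he j j r).1 hrr.
case: (peirce_fitting he hrr) => [[k rk]|[v hv /(nr v hv)//]].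
have -> : e j = (e j - r) * \sum_(i < k.+1) r ^+ i.
  have -> : e j - r = e j * (1 - r) by rewrite mulrBr mulr1 er.
  have : (1 - r) * \sum_(i < k.+1) r ^+ i = 1.
    have := subrX1 r k.+1; rewrite rk sub0r -(opprB 1 r) mulNr => /oppr_inj.
    by move=> <-.
  by rewrite -mulrA => ->; rewrite mulr1.
by rewrite (subvP UR) // memv_mul // memvf.
Qed.

(** The Jacobson radical of a basic algebra, seen through its diagonal Peirce
    components: the off-diagonal ones are unrestricted because a product
    e_i R e_k R e_i with i != k is already radical. *)
Definition rad_elt r := forall i, e i * r * e i \in corner_rad e i.
Definition rad_space : {vspace R} := vspace_of rad_elt.

Lemma rad_spaceP r : r \in rad_space <-> rad_elt r.
Proof.
apply: vspace_ofP => [i|a u v hu hv i]; first by rewrite mulr0 mul0r mem0v.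
by rewrite mulrDr mulrDl -scalerAr -scalerAl memvD ?memvZ.
Qed.

Lemma rad_eltMr r s : rad_elt r -> rad_elt (r * s).
Proof.
move=> hr i; rewrite (sum_idem_r r) mulr_suml mulr_sumr mulr_suml.
apply: memv_suml => k _.
have -> : e i * (r * e k * s) * e i = (e i * r * e k) * (e k * s * e i).
  by rewrite !mulrA -[_ * e k * e k]mulrA idemM eqxx.
have [<-|ik] := eqVneq i k.
  by apply: (corner_radMr he) => //; apply: peirce_comp.
by apply: (corner_radM he hb ik); apply: peirce_comp.
Qed.

Lemma corner_rad_sub_rad j r : r \in corner_rad e j -> rad_elt r.
Proof.
move=> hr i; have [er _] := (peirceE he j j r).1 (subvP (corner_rad_sub he _) _ hr).
have [ij|ij] := eqVneq i j.
  by subst i; rewrite er; apply: (corner_radMr he) => //; apply: (peirce_id he).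
by rewrite -er !mulrA idemM (negbTE ij) !mul0r mem0v.
Qed.

Lemma rad_spaceMr : (rad_space * {:R} <= rad_space)%VS.
Proof.
by apply/prodvP=> r s /rad_spaceP hr _; apply/rad_spaceP; apply: rad_eltMr.
Qed.

(** For each j the submodule (u e_j) rad of U is 0 or U; in the second case
    u e_j = u e_j r for some r in the radical of the j-th corner, and u e_j = 0
    after all. *)
Lemma simple_mul_rad U u r :
  simple_module {:R} U -> u \in U -> rad_elt r -> u * r = 0.
Proof.
move=> [UR _ simU] hu /rad_spaceP hr.
rewrite (sum_idem_r u) mulr_suml big1 // => j _; set u' := u * e j.
have hu' : u' \in U by rewrite (subvP UR) // memv_mul // memvf.
have sW : submodule {:R} U (<[u']> * rad_space)%VS.
  rewrite /submodule -prodvA prodvSr ?rad_spaceMr // andbT.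
  by apply: subv_trans UR; apply: prodvS; rewrite ?subvf // -memvE.
case: (simU _ sW) => hW.
  by apply/eqP; rewrite -memv0 -hW memv_mul ?memv_line.
rewrite -hW in hu'; have [q /rad_spaceP hq uq] := memv_lineMP hu'.
suff -> : u' = 0 by rewrite mul0r.
apply: (corner_rad_fix0 (hq j)).
have -> : u' * (e j * q * e j) = u' * q * e j.
  by rewrite !mulrA -[u' * e j]mulrA idemM eqxx.
by rewrite -uq /u' -mulrA idemM eqxx.
Qed.

(** If a maximal right ideal U misses e_j rad, then e_j lies in U + e_j rad, and
    solving for e_j inside the local corner puts e_j itself into U. *)
Lemma rad_sub_jacobson r : rad_elt r -> r \in jacobson {:R}.
Proof.
move=> hr; apply/jacobsonP; split=> [|U [/andP[_ UR] nU maxU]]; first exact: memvf.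
case: he => _ _ s1; rewrite -[r]mul1r -s1 mulr_suml.
apply: memv_suml => j _.
case: (boolP (e j \in U)) => [ejU|ejU].
  by rewrite (subvP UR) // memv_mul // memvf.
have sV : submodule {:R} {:R} (U + <[e j]> * rad_space)%VS.
  rewrite /submodule subvf prodvDl addvS //.
  by rewrite -prodvA prodvSr ?rad_spaceMr.
case: (maxU _ sV (addvSl _ _)) => [<-|VR].
  by rewrite (subvP (addvSr _ _)) // memv_mul ?memv_line //; apply/rad_spaceP.
case/negP: ejU; have : e j \in {:R}%VS by apply: memvf.
rewrite -VR => /memv_addP[u uU [w /memv_lineMP[q /rad_spaceP hq ->]]] ej.
apply: (idem_mem_of_sub_rad (hq j)) => //.
have -> : e j - e j * q * e j = u * e j.
  by rewrite -[X in X - _](idem_mul he j) -[_ - _]mulrBl {1}ej addrK.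
by rewrite (subvP UR) // memv_mul // memvf.
Qed.

Lemma right_projE i r : r \in right_proj e i <-> e i * r = r.
Proof.
split=> [/memv_lineMP[q _ ->]|<-]; first by rewrite mulrA (idem_mul he).
by rewrite memv_mul ?memv_line ?memvf.
Qed.

Lemma exists_simple_submodule U : (U * {:R} <= U)%VS -> U <> 0%VS ->
  exists W, submodule {:R} U W /\ simple_module {:R} W.
Proof.
move=> UR U0.
pose P d := `[< exists W, [/\ submodule {:R} U W, W <> 0%VS & \dim W = d] >].
have exP : exists d, P d.
  exists (\dim U); apply/asboolP; exists U; split=> //.
  by rewrite /submodule subvv.
case: (ex_minnP exP) => d /asboolP[W [/andP[WU WR] W0 dW]] min_d.
exists W; split; first by rewrite /submodule WU.
split=> // V /andP[VW VR]; case: (eqVneq V 0%VS) => [|/eqP V0]; first by left.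
right; apply/eqP; rewrite eqEdim VW dW; apply: min_d; apply/asboolP.
by exists V; split=> //; rewrite /submodule (subv_trans VW).
Qed.

Hypothesis split_corner : forall i r, r \in peirce e i i ->
  exists c : K, r - c *: e i \in corner_rad e i.

Lemma split_right_proj i r : r \in right_proj e i ->
  exists c : K, rad_elt (r - c *: e i).
Proof.
move=> /right_projE er; have [c hc] := split_corner (peirce_comp i i r).
exists c => k; have [ki|ki] := eqVneq k i.
  subst k; rewrite mulrBr mulrBl -scalerAr -scalerAl !idemM eqxx idemM eqxx.
  exact: hc.
have -> : e k * (r - c *: e i) = 0.
  by rewrite -er mulrBr -scalerAr mulrA !idemM (negbTE ki) mul0r scaler0 subrr.
by rewrite mul0r mem0v.
Qed.

Section Socle.
Variables (i f : 'I_m) (x : R).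
Hypothesis top_socle : subquotient_iso {:R} (socle {:R} (right_proj e i)) 0
  (right_proj e f) (<[e f]> * jacobson {:R})%VS.
Hypotheses (x_neq0 : x != 0) (x_socle : x \in socle {:R} (right_proj e i)).
Hypothesis x_target : x * e f = x.

Lemma socle_mul_rad z r :
  z \in socle {:R} (right_proj e i) -> rad_elt r -> z * r = 0.
Proof.
move=> /socleP[s [hs hz]] hr.
suff /subvP/(_ z hz) : (\sum_(U <- s) U <= lker (amulr r))%VS.
  by rewrite memv_ker lfunE => /eqP.
rewrite big_seq; elim/big_ind: _ => [|U V hU hV|U /hs[_ simU]].
- exact: sub0v.
- by rewrite subv_add hU.
by apply/subvP=> u hu; rewrite memv_ker lfunE /= (simple_mul_rad simU).
Qed.

Lemma socle_source z : z \in socle {:R} (right_proj e i) -> e i * z = z.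
Proof.
move=> /socleP[s [hs hz]]; apply/right_projE; apply: subvP hz.
rewrite big_seq; elim/big_ind: _ => [|U V hU hV|U /hs[/andP[]]//].
  exact: sub0v.
by rewrite subv_add hU.
Qed.

(** The isomorphism embeds the socle into the top of e_f R, which is spanned by
    the class of e_f because e_f R is K e_f plus radical elements. *)
Lemma socle_line z : z \in socle {:R} (right_proj e i) -> exists c : K, z = c *: x.
Proof.
move=> hz; case: top_socle => g [gU _ gker _].
have top u : u \in socle {:R} (right_proj e i) ->
    exists c : K, g u - c *: e f \in (<[e f]> * jacobson {:R})%VS.
  move=> hu; have hgu : g u \in right_proj e f by rewrite (subvP gU) // memv_img.
  have [c hc] := split_right_proj hgu; exists c.
  have -> : g u - c *: e f = e f * (g u - c *: e f).
    by rewrite mulrBr -scalerAr (idem_mul he) ((right_projE f _).1 hgu).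
  by rewrite memv_mul ?memv_line // rad_sub_jacobson.
have [a ha] := top x x_socle; have [b hb'] := top z hz.
have a0 : a != 0.
  apply: contraNneq x_neq0 => a0; move: ha; rewrite a0 scale0r subr0 gker //.
  by rewrite memv0.
exists (b / a); apply/eqP; rewrite -subr_eq0 -memv0 -gker; last first.
  by rewrite memvB // memvZ.
have -> : g (z - b / a *: x) = (g z - b *: e f) - (b / a) *: (g x - a *: e f).
  by rewrite linearB linearZ /= scalerBr scalerA divfK // opprB addrA subrK.
by rewrite memvB // memvZ.
Qed.

(** The socle of e_i R e_f over the corner e_f R e_f is the line of the right
    socle of e_i R.  An element z of a simple corner module is killed by the
    radical of the corner; the right ideal z R contains a simple module, which
    must be K x, so that x = z q = z (e_f q e_f) is a multiple of z. *)
Lemma corner_socleP z :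
  z \in socle (peirce e f f) (peirce e i f) <-> exists c : K, z = c *: x.
Proof.
have xQ q : q \in peirce e f f -> exists c : K, x * q = c *: x.
  move=> /split_corner[c hc]; exists c; apply/eqP; rewrite -subr_eq0.
  rewrite -{2}x_target scalerAr -mulrBr.
  by rewrite socle_mul_rad //; apply: corner_rad_sub_rad hc.
have hx : x \in peirce e i f by apply/(peirceE he); rewrite socle_source.
split=> [/socleP[s [hs hz]]|[c ->]]; last first.
  apply: memvZ; apply/socleP; exists [:: <[x]>%VS]; split; last first.
    by rewrite big_seq1 memv_line.
  move=> U; rewrite inE => /eqP ->.
  have xx : (<[x]> * peirce e f f <= <[x]>)%VS.
    apply/subvP=> _ /memv_lineMP[q hq ->]; have [d ->] := xQ q hq.
    by rewrite memvZ ?memv_line.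
  split; first by rewrite /submodule xx -memvE hx.
  split=> // [x0|V /andP[Vx _]].
    by move: (memv_line x); rewrite x0 memv0 (negbTE x_neq0).
  have [->|V0] := eqVneq V 0%VS; first by left.
  right; apply/eqP; rewrite eqEdim Vx dim_vline x_neq0.
  by rewrite lt0n dimv_eq0.
suff sx U : U \in s -> (U <= <[x]>)%VS.
  apply/vlineP; apply: subvP hz.
  rewrite big_seq; elim/big_ind: _ => [|U V hU hV|U /sx//].
    exact: sub0v.
  by rewrite subv_add hU.
move=> {hz z} /hs[/andP[Ui _] [UQ _ simU]]; apply/subvP=> z zU.
have [-> |z0] := eqVneq z 0; first exact: mem0v.
have [ez ze] := (peirceE he _ _ _).1 (subvP Ui _ zU).
have sW : submodule (peirce e f f) U (<[z]> * corner_rad e f)%VS.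
  rewrite /submodule -prodvA prodvSr ?andbT; last first.
    by apply/prodvP=> a b; apply: corner_radMr he _ _ _.
  by apply: subv_trans UQ; apply: prodvS; rewrite ?(corner_rad_sub he) // -memvE.
have zrad r : r \in corner_rad e f -> z * r = 0.
  move=> hr; case: (simU _ sW) => hW.
    by apply/eqP; rewrite -memv0 -hW memv_mul ?memv_line.
  move: zU; rewrite -hW => /memv_lineMP[q hq /(corner_rad_fix0 hq) z00].
  by rewrite z00 eqxx in z0.
(* The right ideal z R is nonzero, so it meets the socle of e_i R. *)
have zR : (<[z]> * {:R} * {:R} <= <[z]> * {:R})%VS by rewrite -prodvA prodvSr ?subvf.
have zR0 : (<[z]> * {:R})%VS <> 0%VS.
  move=> h0; have : z * 1 \in (<[z]> * {:R})%VS by rewrite memv_mul ?memv_line ?memvf.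
  by rewrite h0 memv0 mulr1 (negbTE z0).
have [W [/andP[Wz WR] simW]] := exists_simple_submodule zR zR0.
have Wi : (W <= right_proj e i)%VS.
  apply: subv_trans Wz _; apply/subvP=> _ /memv_lineMP[q _ ->].
  by apply/right_projE; rewrite mulrA ez.
have WS : (W <= socle {:R} (right_proj e i))%VS.
  apply/subvP=> w hw; apply/socleP; exists [:: W]; split; last by rewrite big_seq1.
  by move=> V; rewrite inE => /eqP ->; split=> //; rewrite /submodule Wi WR.
have [w hw w0] : exists2 w, w \in W & w != 0.
  by exists (vpick W); rewrite ?memv_pick // vpick0; apply/eqP; case: simW.
have [a wa] := socle_line (subvP WS _ hw).
have [q _ wq] := memv_lineMP (subvP Wz _ hw).
have [c hc] := split_corner (peirce_comp f f q).
have wcz : w = c *: z.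
  have -> : w = z * (e f * q * e f).
    by rewrite !mulrA ze -wq wa -scalerAl x_target.
  apply/eqP; rewrite -subr_eq0 -{2}ze scalerAr -mulrBr.
  by rewrite zrad.
have c0 : c != 0 by apply: contraNneq w0 => c0; rewrite wcz c0 scale0r.
apply/vlineP; exists (a / c); apply: (scalerI c0).
by rewrite -wcz wa scalerA mulrC divfK.
Qed.

End Socle.
End Radical.

(** * Paths and their images in the algebra *)

Section PathAlgebraFacts.
Variables (K : fieldType) (Q : quiver).
Implicit Types (p q r : qpath Q) (v : vertex Q) (a : arrow Q).

Lemma path_alg_ind (P : path_alg K Q -> Prop) :
    P 0 -> (forall c x y, P x -> P y -> P (c *: x + y)) ->
    (forall p, P (of_path K p)) -> forall x, P x.
Proof.
move=> P0 Plin Ppath x; rewrite [x]path_algE; elim/big_rec: _ => // p y _.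
by apply: Plin.
Qed.

Lemma vertex_mul_path v p :
  vertex_elt K v * of_path K p = if v == psource p then of_path K p else 0.
Proof. by rewrite of_pathM pconcat_trivl; case: ifP. Qed.

Lemma path_mul_vertex v p :
  of_path K p * vertex_elt K v = if v == ptarget p then of_path K p else 0.
Proof. by rewrite of_pathM pconcat_trivr; case: ifP. Qed.

Lemma vertex_mul_arrow v a :
  vertex_elt K v * arrow_elt K a = if v == source a then arrow_elt K a else 0.
Proof. exact: vertex_mul_path. Qed.

Lemma arrow_mul_vertex v a :
  arrow_elt K a * vertex_elt K v = if v == target a then arrow_elt K a else 0.
Proof. exact: path_mul_vertex. Qed.

Lemma vertex_mul_vertex v v' :
  vertex_elt K v * vertex_elt K v' = if v == v' then vertex_elt K v else 0.
Proof.
by rewrite vertex_mul_path [psource _]/=; case: eqP => [->|].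
Qed.

Lemma of_path_cat p q : ptarget p = psource q -> exists r,
  [/\ of_path K p * of_path K q = of_path K r, psource r = psource p,
      parrows r = parrows p ++ parrows q & ptarget r = ptarget q].
Proof.
by case/pconcat_ok=> r [pq sr ar tr]; exists r; split; rewrite // of_pathM pq.
Qed.

Lemma trivial_pathE p : parrows p = [::] -> p = trivial_path (psource p).
Proof. by move=> p0; apply: qpath_eq; rewrite ?p0. Qed.

(** Paths are built by prepending arrows, as the extension map and the erasure
    of the arrows delta both consume a path from its source. *)
Lemma path_ind (P : qpath Q -> Prop) :
    (forall v, P (trivial_path v)) ->
    (forall a q r, psource q = target a -> psource r = source a ->
       ptarget r = ptarget q -> parrows r = a :: parrows q ->
       of_path K r = arrow_elt K a * of_path K q -> P q -> P r) ->
  forall p, P p.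
Proof.
move=> Ptriv Pcons p; move: {2}(parrows p) (erefl (parrows p)) => s.
elim: s p => [|a s IH] p ps; first by rewrite (trivial_pathE ps).
have := valP p; rewrite -/(psource p) -/(parrows p) ps /= => /andP[/eqP sa ws].
pose q := @QPath Q (target a, s) ws.
have aq : ptarget (arrow_path a) = psource q by [].
have [r [rE sr ar tr]] := of_path_cat aq.
have -> : p = r by apply: qpath_eq; rewrite ?sr ?ar // -sa.
exact: (Pcons a q) (IH q (erefl _)).
Qed.

End PathAlgebraFacts.

Section Presentation.
Variables (K : fieldType) (R : falgType K) (m : nat) (e : 'I_m -> R).
Hypotheses (he : complete_primitive_orthogonal e) (hb : basic_algebra e).
Variable phi : {lrmorphism path_alg K (alg_quiver he) -> R}.
Hypothesis phi_vertex : forall i : 'I_m, phi (@vertex_elt K (alg_quiver he) i) = e i.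
Hypothesis phi_arrow : forall a : arrow (alg_quiver he),
  phi (arrow_elt K a) \in arrow_space e (source a) (target a).

Local Notation KQ := (path_alg K (alg_quiver he)).
Implicit Types (p q : qpath (alg_quiver he)) (i j : 'I_m) (a : KQ).

Lemma phi_path_peirce p : phi (of_path K p) \in peirce e (psource p) (ptarget p).
Proof.
apply/(peirceE he); split.
  by rewrite -phi_vertex -rmorphM /= vertex_mul_path eqxx.
by rewrite -phi_vertex -rmorphM /= path_mul_vertex eqxx.
Qed.

(** The first arrow of a closed path is either a loop, with radical image, or
    leaves i; in the latter case the path factors through another vertex and
    basicness applies. *)
Lemma phi_loop_rad p i : psource p = i -> ptarget p = i -> parrows p != [::] ->
  phi (of_path K p) \in corner_rad e i.
Proof.
elim/(@path_ind K): p => // a q r sq sr tr ar rE _ ri ti _.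
rewrite rE rmorphM; have := phi_arrow a; rewrite -sr ri -sq /arrow_space.
have hq := phi_path_peirce q; rewrite -tr ti in hq.
case: eqP => [iq|/eqP iq] ha; last exact: (corner_radM he hb iq).
by rewrite -iq in hq; apply: (corner_radMr he).
Qed.

Definition triv_coef i : KQ -> K^o :=
  linear_ext (fun p => (p == trivial_path (Q := alg_quiver he) i)%:R : K^o).

(** The component in e_i KQ e_j, without the trivial path. *)
Definition pos_part i j : KQ -> KQ :=
  linear_ext (fun p => if [&& psource p == i, ptarget p == j & parrows p != [::]]
                       then of_path K p else 0).

HB.instance Definition _ i := GRing.Linear.on (triv_coef i).
HB.instance Definition _ i j := GRing.Linear.on (pos_part i j).

Lemma triv_coef_lin i c a b :
  triv_coef i (c *: a + b) = c * triv_coef i a + triv_coef i b.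
Proof. exact: linearP. Qed.

Lemma triv_coef_path i p : triv_coef i (of_path K p) =
  ((psource p == i) && (parrows p == [::]))%:R.
Proof. by rewrite /triv_coef linear_ext_path. Qed.

Lemma phi_split_neq i j a : i != j -> e i * phi a * e j = phi (pos_part i j a).
Proof.
move=> ij; elim/path_alg_ind: a => [|c a b IHa IHb|p].
- by rewrite !linear0 mulr0 mul0r.
- by rewrite !linearP mulrDr mulrDl -scalerAr -scalerAl IHa IHb.
rewrite /pos_part linear_ext_path -!phi_vertex -!rmorphM /=.
rewrite vertex_mul_path eq_sym.
have [si|] := eqVneq (psource p) i => /=; last by rewrite mul0r rmorph0.
rewrite path_mul_vertex (eq_sym j).
have [p0|p0] := eqVneq (parrows p) [::] => /=; last by rewrite andbT.
by rewrite andbF /ptarget p0 si (negbTE ij).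
Qed.

(** Every corner is K e_i plus the image of the nontrivial closed paths, which
    is what makes the corners split over K. *)
Lemma phi_split i a :
  e i * phi a * e i = triv_coef i a *: e i + phi (pos_part i i a).
Proof.
elim/path_alg_ind: a => [|c a b IHa IHb|p].
- by rewrite !linear0 mulr0 mul0r scale0r addr0.
- rewrite !linearP mulrDr mulrDl -scalerAr -scalerAl IHa IHb.
  by rewrite [c *: (_ + _)]scalerDr [(_ + _) *: _]scalerDl addrACA scalerA.
rewrite triv_coef_path /pos_part linear_ext_path -!phi_vertex -!rmorphM /=.
rewrite vertex_mul_path eq_sym.
have [si|] := eqVneq (psource p) i => /=; last first.
  by rewrite mul0r !rmorph0 scale0r addr0.
rewrite path_mul_vertex (eq_sym i).
have [p0|p0] := eqVneq (parrows p) [::] => /=; last by rewrite andbT scale0r add0r.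
have tp : ptarget p = i by rewrite /ptarget p0 -si.
by rewrite andbF rmorph0 addr0 scale1r tp eqxx {1}(trivial_pathE p0) si.
Qed.

Lemma phi_pos_lin i j c a b :
  phi (pos_part i j (c *: a + b)) = c *: phi (pos_part i j a) + phi (pos_part i j b).
Proof. by rewrite !linearP. Qed.

Lemma phi_pos_rad i a : phi (pos_part i i a) \in corner_rad e i.
Proof.
elim/path_alg_ind: a => [|c a b IHa IHb|p].
- by rewrite !linear0 mem0v.
- by rewrite phi_pos_lin; apply: memvD IHb; apply: memvZ.
rewrite /pos_part linear_ext_path; case: and3P => [[/eqP si /eqP ti p0]|_].
  exact: phi_loop_rad.
by rewrite rmorph0 mem0v.
Qed.

Lemma scale_idem_rad i (c : K) : c *: e i \in corner_rad e i -> c = 0.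
Proof.
move=> hc; apply/eqP; apply: contraT => c0.
by case/negP: (idem_notin_rad he i); rewrite -[e i](scalerK c0) memvZ.
Qed.

(** The trivial path is detected modulo the radical; with a in Ker phi this
    says that Ker phi lies in the span of the nontrivial paths. *)
Lemma triv_coef_rad i a : e i * phi a * e i \in corner_rad e i -> triv_coef i a = 0.
Proof.
move=> hr; apply: (@scale_idem_rad i).
have -> : triv_coef i a *: e i = e i * phi a * e i - phi (pos_part i i a).
  by rewrite phi_split addrK.
by rewrite memvB // phi_pos_rad.
Qed.

Lemma ker_triv_coef i a : phi a = 0 -> triv_coef i a = 0.
Proof. by move=> a0; apply: triv_coef_rad; rewrite a0 mulr0 mul0r mem0v. Qed.

Lemma split_corner (phi_surj : forall r : R, exists a, phi a = r) i r :
  r \in peirce e i i -> exists c : K, r - c *: e i \in corner_rad e i.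
Proof.
move=> /(peirceE he)[er re]; have [a ar] := phi_surj r.
exists (triv_coef i a); rewrite -re -er -ar phi_split addrC addKr.
exact: phi_pos_rad.
Qed.

End Presentation.

(** * Segments, extensions and collapses in the block quiver *)

(** Consecutive intervals of an ordered product; the factors need not commute. *)
Lemma prod_ord_interval_cat (A : pzRingType) N (F : 'I_N -> A) (a l b : nat) :
  (a <= l)%N -> (l <= b)%N ->
  \prod_(j < N | (a <= j < b)%N) F j
    = \prod_(j < N | (a <= j < l)%N) F j * \prod_(j < N | (l <= j < b)%N) F j.
Proof.
move=> al lb; elim: N F => [|N IH] F; first by rewrite !big_ord0 mulr1.
rewrite ![\prod_(j < N.+1 | _) _]big_mkcond !big_ord_recr /= -!big_mkcond /=.
rewrite IH; have [Nl|lN] := ltnP N l.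
  have -> : (N < b)%N by apply: leq_trans lb.
  rewrite andFb mulr1 !andbT (@big_pred0 _ _ _ _ _ (fun j : 'I_N => (l <= j < b)%N)).
    by rewrite !mulr1.
  by move=> j; rewrite leqNgt (leq_trans (ltn_ord j) (ltnW Nl)).
by rewrite (leq_trans al lN) andbF mulr1 mulrA.
Qed.

Section BlockQuiver.
Variables (K : fieldType) (R : falgType K) (m : nat) (e : 'I_m -> R).
Hypothesis he : complete_primitive_orthogonal e.
Variables (n : 'I_m -> nat) (n_gt0 : forall i, (0 < n i)%N).

Local Notation Q := (alg_quiver he).
Local Notation Q' := (block_quiver he n_gt0).
Local Notation KQ := (path_alg K Q).
Local Notation KQ' := (path_alg K Q').
Implicit Types (i : 'I_m) (x y : block_index n) (p q : qpath Q').

Definition level x : nat := tagged x.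

Lemma level_lt x : (level x < n (tag x))%N.
Proof. exact: ltn_ord. Qed.

Lemma block_index_eq x y : tag x = tag y -> level x = level y -> x = y.
Proof.
rewrite /level; case: x y => [i j] [i' j'] /= ii; subst i' => jj.
by congr existT; apply: val_inj.
Qed.

(** Rows and columns are handled by natural number levels, counted from 0, which
    avoids transporting ordinals along equalities of blocks; a level out of
    range is sent to 0. *)
Definition idx i (k : nat) : block_index n := mk_index (insubd (Ordinal (n_gt0 i)) k).

Lemma level_idx i k : (k < n i)%N -> level (idx i k) = k.
Proof. by move=> kn; rewrite /level /= val_insubd kn. Qed.

Lemma idxE x : idx (tag x) (level x) = x.
Proof. by apply: block_index_eq; rewrite ?level_idx ?level_lt. Qed.

Lemma eq_idx x i k : (k < n i)%N -> (x == idx i k) = (tag x == i) && (level x == k).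
Proof.
move=> kn; apply/eqP/andP=> [->|[/eqP ti /eqP lk]]; first by rewrite level_idx.
by apply: block_index_eq; rewrite ?level_idx.
Qed.

Lemma first_indexE i : first_index n_gt0 i = idx i 0.
Proof. by apply: block_index_eq; rewrite ?level_idx. Qed.

Lemma last_indexE i : last_index n_gt0 i = idx i (n i).-1.
Proof. by apply: block_index_eq; rewrite ?level_idx // ltn_predL. Qed.

Lemma delta_sourceE i (j : 'I_(n i).-1) :
  mk_index (Ordinal (delta_source_subproof j)) = idx i j.
Proof. by apply: block_index_eq; rewrite ?level_idx // (delta_source_subproof j). Qed.

Lemma delta_targetE i (j : 'I_(n i).-1) :
  mk_index (Ordinal (delta_target_subproof j)) = idx i j.+1.
Proof. by apply: block_index_eq; rewrite ?level_idx // (delta_target_subproof j). Qed.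

(** The source and target relations of the arrows of the quiver of the block
    extension, in any algebra.  The formulas about segments and extensions hold
    wherever these relations do. *)
Record block_relations (A : algType K) (vx : block_index n -> A)
    (dl : forall i, 'I_(n i).-1 -> A) (bt : arrow Q -> A) : Prop := {
  rel_vertex : forall x y, vx x * vx y = if x == y then vx x else 0;
  rel_vertex_delta : forall i (j : 'I_(n i).-1),
    vx (idx i j) * dl i j = dl i j;
  rel_delta_vertex : forall i (j : 'I_(n i).-1),
    dl i j * vx (idx i j.+1) = dl i j;
  rel_vertex_beta : forall a : arrow Q,
    vx (idx (source a) (n (source a)).-1) * bt a = bt a;
  rel_beta_vertex : forall a : arrow Q,
    bt a * vx (idx (target a) 0) = bt a
}.

Section Relations.
Variables (A : algType K) (vx : block_index n -> A).
Variables (dl : forall i, 'I_(n i).-1 -> A) (bt : arrow Q -> A).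
Hypothesis rel : block_relations vx dl bt.

(** The product of the arrows delta leading from level a to level b, without the
    idempotents at its ends: it is 1 when a >= b. *)
Definition delta_seg i (a b : nat) : A :=
  \prod_(j < (n i).-1 | (a <= j < b)%N) dl j.

Definition full_seg i : A := vx (idx i 0) * delta_seg i 0 (n i).-1.

Lemma full_segE i : full_seg i = vx (first_index n_gt0 i) * \prod_j @dl i j.
Proof.
rewrite /full_seg first_indexE; congr (_ * _).
by apply: eq_bigl => j; rewrite ltn_ord.
Qed.

Fixpoint ext_word (s : seq (arrow Q)) : A :=
  match s with
  | [::] => 0
  | [:: a] => bt a
  | a :: s' => bt a * full_seg (target a) * ext_word s'
  end.

Lemma ext_word_nil : ext_word [::] = 0. Proof. by []. Qed.

Lemma delta_seg_nil i a b : (b <= a)%N -> delta_seg i a b = 1.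
Proof.
move=> ba; rewrite /delta_seg big_pred0 // => j.
by apply/negP=> /andP[aj jb]; have := leq_trans jb (leq_trans ba aj); rewrite ltnn.
Qed.

Lemma delta_seg_cat i a l b : (a <= l)%N -> (l <= b)%N ->
  delta_seg i a b = delta_seg i a l * delta_seg i l b.
Proof. exact: prod_ord_interval_cat. Qed.

(** With z = e(theta_i) this says that theta'_i(u, v) is a multiple of
    theta'_i(l, c) as soon as u <= l and c <= v. *)
Lemma delta_seg_sandwich i k (a l v c : nat) (z : A) :
  (a <= l)%N -> (l <= (n i).-1)%N -> (c <= v)%N ->
  delta_seg i a (n i).-1 * z * delta_seg k 0 v
    = delta_seg i a l * (delta_seg i l (n i).-1 * z * delta_seg k 0 c) * delta_seg k c v.
Proof.
by move=> al ln cv; rewrite (delta_seg_cat i al ln) (@delta_seg_cat k 0 c v) // !mulrA.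
Qed.

Lemma delta_seg_delta i (j : 'I_(n i).-1) : delta_seg i j j.+1 = dl j.
Proof.
by rewrite /delta_seg (big_pred1 j) // => k; rewrite /= -val_eqE /= eqn_leq ltnS andbC.
Qed.

Lemma ext_word_cons (a b : arrow Q) s :
  ext_word [:: a, b & s] = bt a * full_seg (target a) * ext_word (b :: s).
Proof. by []. Qed.

Lemma vertex_delta_seg i a b : (a <= b)%N -> (b < n i)%N ->
  vx (idx i a) * delta_seg i a b = delta_seg i a b * vx (idx i b).
Proof.
move=> /subnK <-; elim: (b - a)%N => [|d IH] dn; first by rewrite delta_seg_nil ?mulr1 ?mul1r.
rewrite addSn in dn *; have hd : (d + a < (n i).-1)%N by rewrite ltn_predRL.
have -> : delta_seg i a (d + a).+1 = delta_seg i a (d + a) * dl (Ordinal hd).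
  by rewrite -(delta_seg_delta (Ordinal hd)); apply: delta_seg_cat (leq_addl d a) (leqnSn _).
rewrite mulrA IH; last exact: ltnW.
rewrite -[LHS]mulrA (rel_vertex_delta rel (Ordinal hd)).
by rewrite -[RHS]mulrA (rel_delta_vertex rel (Ordinal hd)).
Qed.

Lemma vertex_ext_word (a : arrow Q) s :
  vx (idx (source a) (n (source a)).-1) * ext_word (a :: s) = ext_word (a :: s).
Proof. by case: s => [|b s]; rewrite ?ext_word_cons ?mulrA (rel_vertex_beta rel). Qed.

Lemma ext_word_vertex (a : arrow Q) s :
  ext_word (a :: s) * vx (idx (walk_end (source a) (a :: s)) 0) = ext_word (a :: s).
Proof.
elim: s a => [|b s IH] a; first exact: (rel_beta_vertex rel).
by rewrite ext_word_cons -mulrA -{2}IH.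
Qed.

(** The extension map inserts one full segment at every inner vertex; this is
    the vertex where the two words meet. *)
Lemma ext_word_cat (v : vertex Q) s t : s != [::] -> t != [::] ->
  ext_word (s ++ t) = ext_word s * full_seg (walk_end v s) * ext_word t.
Proof.
case: t => // b t; elim: s v => // a [|a' s] IH v _ _; first exact: ext_word_cons.
by rewrite !cat_cons !ext_word_cons -cat_cons (IH (target a)) // !mulrA.
Qed.

Lemma vertex_ext_word_path (p : qpath Q) :
  vx (idx (psource p) (n (psource p)).-1) * ext_word (parrows p) = ext_word (parrows p).
Proof.
have := valP p; rewrite -/(psource p) -/(parrows p).
case: (parrows p) => [|a s] /=; first by rewrite mulr0.
by case/andP=> /eqP <- _; apply: vertex_ext_word.
Qed.

Lemma ext_word_path_vertex (p : qpath Q) :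
  ext_word (parrows p) * vx (idx (ptarget p) 0) = ext_word (parrows p).
Proof.
have := valP p; rewrite /ptarget -/(psource p) -/(parrows p).
case: (parrows p) => [|a s] /=; first by rewrite mul0r.
by case/andP=> /eqP <- _; apply: ext_word_vertex.
Qed.

Lemma full_seg_vertex i : full_seg i * vx (idx i (n i).-1) = full_seg i.
Proof. by rewrite /full_seg vertex_delta_seg ?ltn_predL // -mulrA (rel_vertex rel) eqxx. Qed.

Lemma vertex_full_seg i : vx (idx i 0) * full_seg i = full_seg i.
Proof. by rewrite /full_seg mulrA (rel_vertex rel) eqxx. Qed.

Definition ext_map : KQ -> A := linear_ext (fun p : qpath Q => ext_word (parrows p)).
HB.instance Definition _ := GRing.Linear.on ext_map.

Lemma ext_map_lin c a b : ext_map (c *: a + b) = c *: ext_map a + ext_map b.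
Proof. exact: linearP. Qed.

Lemma ext_map_path (p : qpath Q) : ext_map (of_path K p) = ext_word (parrows p).
Proof. exact: linear_ext_path. Qed.

Definition ext_factor_l (p : qpath Q) : A :=
  if parrows p == [::] then vx (idx (psource p) (n (psource p)).-1)
  else ext_word (parrows p) * full_seg (ptarget p).

Definition ext_factor_r (p : qpath Q) : A :=
  if parrows p == [::] then vx (idx (psource p) 0)
  else full_seg (psource p) * ext_word (parrows p).

Lemma vertex_idx_mul0 i (k : 'I_m) a b :
  i != k -> vx (idx i a) * vx (idx k b) = 0.
Proof.
move=> ik; rewrite (rel_vertex rel); case: eqP => // /(congr1 tag) /= /eqP.
by rewrite (negbTE ik).
Qed.

(** Extension fails to be multiplicative only at trivial paths: the scalar term
    corrects for e being 0 on them.  When p and q do not match, both sides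
    vanish because the idempotents at the junction are orthogonal. *)
Lemma ext_word_concatl (p q : qpath Q) :
  oapp (fun r => ext_word (parrows r)) 0 (pconcat p q)
    = ext_factor_l p * ext_word (parrows q)
      + ((psource q == ptarget p) && (parrows q == [::]))%:R *: ext_word (parrows p).
Proof.
rewrite /ext_factor_l [_ == ptarget p]eq_sym.
have [pq|pq] := eqVneq (ptarget p) (psource q); last first.
  rewrite /pconcat (negbTE pq) scale0r addr0 -(vertex_ext_word_path q).
  case: eqP => [p0|_].
    have {}pq : psource p != psource q by rewrite /ptarget p0 in pq.
    by rewrite mulrA vertex_idx_mul0 ?mul0r.
  rewrite -full_seg_vertex !mulrA -[_ * vx (idx (ptarget p) _) * _]mulrA.
  by rewrite vertex_idx_mul0 // mulr0 mul0r.
have [r [-> sr ar tr]] := pconcat_ok pq; rewrite /oapp ar.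
have [q0|q0] := eqVneq (parrows q) [::].
  by rewrite q0 cats0 ext_word_nil mulr0 add0r scale1r.
rewrite scale0r addr0; have [p0|p0] := eqVneq (parrows p) [::].
  rewrite p0 cat0s.
  by have -> : psource p = psource q; [rewrite -pq /ptarget p0 | rewrite vertex_ext_word_path].
by rewrite (ext_word_cat (psource p)).
Qed.

Lemma ext_word_concatr (p q : qpath Q) :
  oapp (fun r => ext_word (parrows r)) 0 (pconcat q p)
    = ext_word (parrows q) * ext_factor_r p
      + ((psource q == psource p) && (parrows q == [::]))%:R *: ext_word (parrows p).
Proof.
rewrite /ext_factor_r.
have [qp|qp] := eqVneq (ptarget q) (psource p); last first.
  have -> : (psource q == psource p) && (parrows q == [::]) = false.
    by apply/negP=> /andP[/eqP sq /eqP q0]; rewrite /ptarget q0 sq /walk_end eqxx in qp.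
  rewrite /pconcat (negbTE qp) scale0r addr0 -(ext_word_path_vertex q).
  case: eqP => [p0|_]; first by rewrite -mulrA vertex_idx_mul0 ?mulr0.
  rewrite -vertex_full_seg !mulrA -[_ * vx (idx (ptarget q) _) * _]mulrA.
  by rewrite vertex_idx_mul0 // mulr0 !mul0r.
have [r [-> sr ar tr]] := pconcat_ok qp; rewrite /oapp ar.
have [q0|q0] := eqVneq (parrows q) [::].
  have -> : psource q = psource p by rewrite -qp /ptarget q0.
  by rewrite q0 cat0s ext_word_nil mul0r add0r eqxx scale1r.
rewrite andbF scale0r addr0; have [p0|p0] := eqVneq (parrows p) [::].
  by rewrite p0 cats0 -qp ext_word_path_vertex.
by rewrite (ext_word_cat (psource q)) // -[walk_end _ _]/(ptarget q) qp mulrA.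
Qed.

Lemma ext_map_concat (p q : qpath Q) : ext_map (of_path K p * of_path K q)
  = oapp (fun r => ext_word (parrows r)) 0 (pconcat p q).
Proof.
rewrite [X in ext_map X]of_pathM.
by case: (pconcat p q) => [r|]; [apply: ext_map_path | apply: linear0].
Qed.

(** On the span of the nontrivial paths the extension map turns left
    multiplication by p into left multiplication by a fixed element.  So the
    elements of that span with extension in a given ideal are stable under
    multiplication. *)
Lemma ext_map_mull (p : qpath Q) (a : KQ) :
  ext_map (of_path K p * a)
    = ext_factor_l p * ext_map a + triv_coef (ptarget p) a *: ext_word (parrows p).
Proof.
elim/path_alg_ind: a => [|c a b IHa IHb|q].
- by rewrite mulr0 !linear0 mulr0 scale0r addr0.
- have -> : of_path K p * (c *: a + b) = c *: (of_path K p * a) + of_path K p * b.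
    by rewrite mulrDr scalerAr.
  rewrite [LHS]ext_map_lin [X in _ *: X + _ = _]IHa [X in _ + X = _]IHb.
  rewrite [in RHS]ext_map_lin [in RHS]triv_coef_lin.
  rewrite mulrDr [(_ + _) *: _]scalerDl -scalerAr [c *: (_ + _)]scalerDr -scalerA.
  by rewrite addrACA.
by rewrite [LHS]ext_map_concat ext_word_concatl ext_map_path triv_coef_path.
Qed.

Lemma ext_map_mulr (p : qpath Q) (a : KQ) :
  ext_map (a * of_path K p)
    = ext_map a * ext_factor_r p + triv_coef (psource p) a *: ext_word (parrows p).
Proof.
elim/path_alg_ind: a => [|c a b IHa IHb|q].
- by rewrite mul0r !linear0 mul0r scale0r addr0.
- have -> : (c *: a + b) * of_path K p = c *: (a * of_path K p) + b * of_path K p.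
    by rewrite mulrDl scalerAl.
  rewrite [LHS]ext_map_lin [X in _ *: X + _ = _]IHa [X in _ + X = _]IHb.
  rewrite [in RHS]ext_map_lin [in RHS]triv_coef_lin.
  rewrite mulrDl [(_ + _) *: _]scalerDl -scalerAl [c *: (_ + _)]scalerDr -scalerA.
  by rewrite addrACA.
by rewrite [LHS]ext_map_concat ext_word_concatr ext_map_path triv_coef_path.
Qed.

Definition erase_deltas (s : seq (arrow Q')) : seq (arrow Q) :=
  pmap (fun a : block_arrow e n => if a is inr b then Some b else None) s.

Lemma walk_erase_deltas x s : walk (Q := Q') x s ->
  walk (Q := Q) (tag x) (erase_deltas s)
  /\ walk_end (Q := Q) (tag x) (erase_deltas s) = tag (walk_end (Q := Q') x s).
Proof.
elim: s x => // [[d|b]] s IH x /= /andP[/eqP <- /IH[ws es]]; first by split.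
by rewrite eqxx.
Qed.

Definition collapse p : qpath Q :=
  @QPath Q (tag (psource p), erase_deltas (parrows p)) (walk_erase_deltas (valP p)).1.

Lemma parrows_collapse p : parrows (collapse p) = erase_deltas (parrows p).
Proof. by []. Qed.

Lemma ptarget_collapse p : ptarget (collapse p) = tag (ptarget p).
Proof. exact: (walk_erase_deltas (valP p)).2. Qed.

(** A path without arrow beta stays in its block and moves upwards in it, so
    the trivial path only lifts upwards. *)
Lemma walk_erase_deltas_nil x s : walk (Q := Q') x s -> erase_deltas s = [::] ->
  tag x = tag (walk_end (Q := Q') x s)
  /\ (level x <= level (walk_end (Q := Q') x s))%N.
Proof.
elim: s x => // [[[i j]|b]] s IH x //= /andP[/eqP <- /IH h] /h [] /= ts le.
by split=> //; apply: leq_trans le; apply: leqnSn.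
Qed.

Variable ev : qpath Q' -> A.
Hypothesis ev_trivial : forall x, ev (trivial_path (Q := Q') x) = vx x.
Hypothesis ev_cons : forall (a : arrow Q') q r,
  psource q = target a -> psource r = source a -> ptarget r = ptarget q ->
  parrows r = a :: parrows q ->
  ev r = match a with inl d => dl (tagged d) | inr b => bt b end * ev q.

(** A path is determined by its ends and its collapse: the first summand is the
    path of arrows delta, for a trivial collapse, and the second one vanishes in
    that case because the extension map kills trivial paths. *)
Lemma ev_collapse p : ev p =
  (if parrows (collapse p) == [::]
   then vx (psource p) * delta_seg (tag (psource p)) (level (psource p)) (level (ptarget p))
   else 0)
  + delta_seg (tag (psource p)) (level (psource p)) (n (tag (psource p))).-1
    * ext_word (parrows (collapse p))
    * delta_seg (tag (ptarget p)) 0 (level (ptarget p)).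
Proof.
elim/(@path_ind K): p => [v|a q r sq sr tr ar _ IH].
  by rewrite /= delta_seg_nil // mulr1 mulr0 mul0r addr0 ev_trivial.
rewrite (ev_cons sq sr tr ar) {}IH tr !parrows_collapse.
have := walk_erase_deltas_nil (valP q); rewrite -/(psource q) -/(parrows q) -/(ptarget q).
case: a sq sr ar => [[i j]|b] sq sr ar short.
  have xq : psource q = idx i j.+1 by rewrite sq -delta_targetE.
  have xr : psource r = idx i j by rewrite sr -delta_sourceE.
  have [tq tr'] : tag (psource q) = i /\ tag (psource r) = i by rewrite xq xr.
  have lq : level (psource q) = j.+1.
    by rewrite xq level_idx // (delta_target_subproof j).
  have lr : level (psource r) = j by rewrite xr level_idx // (delta_source_subproof j).
  have -> : erase_deltas (parrows r) = erase_deltas (parrows q) by rewrite ar.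
  rewrite -[dl (tagged _)]/(dl j).
  rewrite lq tq in short; rewrite lq tq lr tr' xq xr mulrDr !mulrA.
  rewrite [delta_seg i j (n i).-1](@delta_seg_cat i j j.+1) // delta_seg_delta; congr (_ + _).
  case: eqP => [/short [_ le]|_]; last exact: mulr0.
  rewrite mulrA (rel_delta_vertex rel) (@delta_seg_cat i j j.+1) // delta_seg_delta mulrA.
  by rewrite (rel_vertex_delta rel).
have xq : psource q = idx (target (q := Q) b) 0 by rewrite sq -first_indexE.
have xr : psource r = idx (source (q := Q) b) (n (source (q := Q) b)).-1.
  by rewrite sr -last_indexE.
have tq : tag (psource q) = target (q := Q) b by rewrite xq.
have tr' : tag (psource r) = source (q := Q) b by rewrite xr.
have lq : level (psource q) = 0%N by rewrite xq level_idx.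
have lr : level (psource r) = (n (source (q := Q) b)).-1.
  by rewrite xr level_idx // ltn_predL.
have -> : erase_deltas (parrows r) = (b : arrow Q) :: erase_deltas (parrows q) by rewrite ar.
rewrite tq in short; rewrite lq tq lr tr' xq.
rewrite (@delta_seg_nil _ (n (source (q := Q) b)).-1 (n (source (q := Q) b)).-1) // mul1r add0r.
case: (erase_deltas (parrows q)) short => [|b' s] short; last first.
  by rewrite add0r ext_word_cons /full_seg !mulrA (rel_beta_vertex rel).
have [<- _] := short erefl; rewrite eqxx ext_word_nil mulr0 mul0r addr0 mulrA.
by rewrite (rel_beta_vertex rel).
Qed.
Lemma ev_nontrivial q (p : qpath Q) i k (a b : nat) :
  psource q = idx i a -> ptarget q = idx k b -> (a < n i)%N -> (b < n k)%N ->
  collapse q = p -> parrows p != [::] ->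
  ev q = delta_seg i a (n i).-1 * ext_word (parrows p) * delta_seg k 0 b.
Proof.
move=> sq tq an bn cq p0; rewrite ev_collapse cq (negbTE p0) add0r sq tq.
by rewrite !level_idx.
Qed.

End Relations.
End BlockQuiver.

(** * Lifting paths, and the map from KQ' to matrices *)

Lemma sum_pair1 (A : nmodType) (I : finType) (T : I -> I -> A) (a b : I) :
    (forall x y, (x == a) && (y == b) = false -> T x y = 0) ->
  \sum_x \sum_y T x y = T a b.
Proof.
move=> T0; rewrite (bigD1 a) //= (bigD1 b) //= !big1 ?addr0 // => [x xa|y yb].
  by rewrite big1 // => y _; rewrite T0 // (negbTE xa).
by rewrite T0 // (negbTE yb) andbF.
Qed.

Section BlockPresentation.
Variables (K : fieldType) (R : falgType K) (m : nat) (e : 'I_m -> R).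
Hypotheses (he : complete_primitive_orthogonal e) (hb : basic_algebra e).
Variable phi : {lrmorphism path_alg K (alg_quiver he) -> R}.
Hypothesis phi_vertex : forall i : 'I_m, phi (@vertex_elt K (alg_quiver he) i) = e i.
Hypothesis phi_arrow : forall a : arrow (alg_quiver he),
  phi (arrow_elt K a) \in arrow_space e (source a) (target a).
Variables (n : 'I_m -> nat) (n_gt0 : forall i, (0 < n i)%N).

Local Notation Q := (alg_quiver he).
Local Notation Q' := (block_quiver he n_gt0).
Local Notation KQ := (path_alg K Q).
Local Notation KQ' := (path_alg K Q').
Local Notation idx := (idx n_gt0).
Implicit Types (i : 'I_m) (x y z : block_index n) (p q : qpath Q').

Section Lifting.

Lemma walk_delta i (a b : nat) : (a <= b)%N -> (b < n i)%N -> exists s,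
  [/\ walk (Q := Q') (idx i a) s, walk_end (Q := Q') (idx i a) s = idx i b
    & erase_deltas (he := he) (n_gt0 := n_gt0) s = [::]].
Proof.
move=> /subnK <-; elim: (b - a)%N => [|d IH] dn; first by exists [::].
rewrite addSn in dn *; have [s [ws es ks]] := IH (ltnW dn).
have hd : (d + a < (n i).-1)%N by rewrite ltn_predRL.
pose t : seq (arrow Q') := [:: inl (Tagged (fun i => 'I_(n i).-1) (Ordinal hd))].
exists (s ++ t); split.
- rewrite walk_cat ws es /= andbT; apply/eqP.
  exact: (delta_sourceE n_gt0 (Ordinal hd)).
- by rewrite walk_end_cat es; apply: (delta_targetE n_gt0 (Ordinal hd)).
by rewrite /erase_deltas pmap_cat [pmap _ s]ks.
Qed.

Lemma walk_lift x y (s : seq (arrow Q)) :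
  walk (Q := Q) (tag x) s -> walk_end (Q := Q) (tag x) s = tag y ->
  (s != [::]) || (level x <= level y)%N ->
  exists t, [/\ walk (Q := Q') x t, walk_end (Q := Q') x t = y
              & erase_deltas (he := he) (n_gt0 := n_gt0) t = s].
Proof.
elim: s x => [|a s IH] x.
  rewrite /= => _ xy lxy.
  have [|t [wt et kt]] := @walk_delta (tag y) (level x) (level y) lxy.
    exact: level_lt.
  by exists t; move: wt et; rewrite idxE -xy idxE.
move=> /= /andP[/eqP sa ws] es _.
have lx : (level x <= (n (tag x)).-1)%N by rewrite -ltnS prednK // level_lt.
have [|t [wt et kt]] := @walk_delta (tag x) _ _ lx; first by rewrite ltn_predL.
have [|||t' [wt' et' kt']] := IH (idx (target a) 0); [exact: ws | exact: es | |].
  by rewrite level_idx // orbT.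
have lastE : block_source n_gt0 (inr a : block_arrow e n) = idx (tag x) (n (tag x)).-1.
  by rewrite -sa -last_indexE.
rewrite idxE in wt et.
exists (t ++ (inr a : arrow Q') :: t'); split.
- rewrite walk_cat wt et /=; apply/andP; split; first exact/eqP.
  by rewrite first_indexE.
- by rewrite walk_end_cat et /walk_end /= first_indexE.
by rewrite /erase_deltas pmap_cat [pmap _ t]kt /= [pmap _ t']kt'.
Qed.

(** Existence of the path with a given collapse and given ends; a nontrivial path
    can be lifted between any two levels because it may climb from its first
    vertex to the top of the block and starts afresh at level 0 after a beta. *)
Lemma path_lift x y (p : qpath Q) : psource p = tag x -> ptarget p = tag y ->
  (parrows p != [::]) || (level x <= level y)%N ->
  exists q, [/\ psource q = x, ptarget q = y & collapse q = p].
Proof.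
move=> sp tp h; have wp := valP p; rewrite -/(psource p) -/(parrows p) sp in wp.
have ep : walk_end (Q := Q) (tag x) (parrows p) = tag y by rewrite -sp -tp.
have [t [wt et kt]] := walk_lift wp ep h.
exists (@QPath Q' (x, t) wt); split=> //.
by apply: qpath_eq; rewrite ?sp.
Qed.

End Lifting.

Definition entry_path x y p : R :=
  if (x == psource p) && (y == ptarget p) then phi (of_path K (collapse p)) else 0.

(** The entries of the matrix that block_map b will be. *)
Definition entry x y : KQ' -> R := linear_ext (entry_path x y).
HB.instance Definition _ x y := GRing.Linear.on (entry x y).

Lemma entry_lin x y c (a b : KQ') : entry x y (c *: a + b) = c *: entry x y a + entry x y b.
Proof. exact: linearP. Qed.

Lemma entry_of_path x y p : entry x y (of_path K p) = entry_path x y p.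
Proof. exact: linear_ext_path. Qed.

Lemma collapse_cat p q r : ptarget p = psource q -> psource r = psource p ->
  parrows r = parrows p ++ parrows q ->
  phi (of_path K (collapse r))
  = phi (of_path K (collapse p)) * phi (of_path K (collapse q)).
Proof.
move=> pq sr ar.
have cpq : ptarget (collapse p) = psource (collapse q).
  by rewrite ptarget_collapse pq.
have [r' [rE sr' ar' _]] := of_path_cat K cpq.
rewrite -rmorphM [X in _ = phi X]rE; congr (phi (of_path K _)).
apply: qpath_eq; first by rewrite sr' -[LHS]/(tag (psource r)) sr.
by rewrite ar' !parrows_collapse ar /erase_deltas pmap_cat.
Qed.

Lemma entry_path_concat x y p q : oapp (entry_path x y) 0 (pconcat p q)
  = \sum_z entry_path x z p * entry_path z y q.
Proof.
rewrite (bigD1 (ptarget p)) //= big1 ?addr0; last first.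
  by move=> z zp; rewrite {1}/entry_path (negbTE zp) andbF mul0r.
have [pq|pq] := eqVneq (ptarget p) (psource q); last first.
  by rewrite {1}/pconcat (negbTE pq) /entry_path (negbTE pq) mulr0.
have [r [-> sr ar tr]] := pconcat_ok pq.
rewrite /= /entry_path sr tr pq !eqxx andbT /=.
case: eqP => _ /=; last by rewrite mul0r.
by case: eqP => _; [apply: collapse_cat | rewrite mulr0].
Qed.

Lemma entryM x y (a b : KQ') :
  entry x y (a * b) = \sum_z entry x z a * entry z y b.
Proof.
elim/path_alg_ind: a => [|c a a' IHa IHa'|p].
- by rewrite mul0r [LHS]linear0 big1 // => z _; rewrite linear0 mul0r.
- have -> : (c *: a + a') * b = c *: (a * b) + a' * b by rewrite mulrDl scalerAl.
  rewrite [LHS]entry_lin [X in _ *: X + _ = _]IHa [X in _ + X = _]IHa'.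
  rewrite scaler_sumr -big_split; apply: eq_bigr => z _.
  by rewrite [X in _ = X * _]entry_lin mulrDl scalerAl.
elim/path_alg_ind: b => [|c b b' IHb IHb'|q].
- by rewrite mulr0 [LHS]linear0 big1 // => z _; rewrite linear0 mulr0.
- have -> : of_path K p * (c *: b + b') = c *: (of_path K p * b) + of_path K p * b'.
    by rewrite mulrDr scalerAr.
  rewrite [LHS]entry_lin [X in _ *: X + _ = _]IHb [X in _ + X = _]IHb'.
  rewrite scaler_sumr -big_split; apply: eq_bigr => z _.
  by rewrite [X in _ = _ * X]entry_lin mulrDr scalerAr.
rewrite [X in entry x y X]of_pathM.
transitivity (oapp (entry_path x y) 0 (pconcat p q)).
  by case: (pconcat p q) => [r|]; [apply: entry_of_path | apply: linear0].
rewrite entry_path_concat; apply: eq_bigr => z _.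
by congr (_ * _); rewrite entry_of_path.
Qed.

Lemma entry1 x y : entry x y 1 = if x == y then e (tag x) else 0.
Proof.
have -> : entry x y 1 = \sum_z entry_path x y (trivial_path (Q := Q') z).
  rewrite -[1]/(path_alg_one K Q') linear_sum; apply: eq_bigr => z _.
  exact: entry_of_path.
rewrite (bigD1 x) //= big1 ?addr0; last first.
  by move=> z zx; rewrite /entry_path [psource _]/= eq_sym (negbTE zx).
rewrite /entry_path [psource _]/= eqxx -[ptarget _]/x eq_sym /=.
case: eqP => // _; rewrite -phi_vertex; congr (phi (of_path K _)).
exact: qpath_eq.
Qed.

(** Below the diagonal of a diagonal block only paths with nontrivial collapse
    contribute, and these have radical images. *)
Lemma entry_block x y (b : KQ') : entry x y b \in block_space e x y.
Proof.
elim/path_alg_ind: b => [|c a b ha hb'|p].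
- by rewrite linear0 mem0v.
- by rewrite entry_lin; apply: memvD hb'; apply: memvZ.
rewrite entry_of_path /entry_path.
case: andP => [[/eqP -> /eqP ->]|_]; last exact: mem0v.
have hp := phi_path_peirce phi_vertex (collapse p).
rewrite ptarget_collapse in hp.
rewrite /block_space; case: eqP => tt; last exact: hp.
case: leqP => lt; first by rewrite -tt in hp.
apply: (phi_loop_rad hb phi_vertex phi_arrow) => //.
  by rewrite ptarget_collapse.
apply/eqP=> k0; have [_] := walk_erase_deltas_nil (valP p) k0.
by rewrite leqNgt => /negP; apply.
Qed.

Definition is_entry (b : KQ') x y (r : R) : Prop :=
  forall x' y', entry x' y' b = if (x' == x) && (y' == y) then r else 0.

Lemma is_entry0 x y : is_entry 0 x y 0.
Proof. by move=> x' y'; rewrite linear0 if_same. Qed.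

Lemma is_entry_lin c (a b : KQ') x y r s :
  is_entry a x y r -> is_entry b x y s -> is_entry (c *: a + b) x y (c *: r + s).
Proof.
move=> ha hb' x' y'; rewrite entry_lin ha hb'; case: ifP => // _.
by rewrite scaler0 addr0.
Qed.

Lemma is_entry_scale c (a : KQ') x y r : is_entry a x y r -> is_entry (c *: a) x y (c *: r).
Proof.
by move=> ha; rewrite -[c *: a]addr0 -[c *: r]addr0; apply: is_entry_lin ha (is_entry0 _ _).
Qed.

Lemma is_entry_path p :
  is_entry (of_path K p) (psource p) (ptarget p) (phi (of_path K (collapse p))).
Proof. by move=> x y; rewrite entry_of_path. Qed.

Lemma is_entry_pos x y (a : KQ) :
  exists b, is_entry b x y (phi (pos_part (tag x) (tag y) a)).
Proof.
elim/path_alg_ind: a => [|c a a' [b hb1] [b' hb2]|p].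
- by exists 0; rewrite !linear0; apply: is_entry0.
- by exists (c *: b + b'); rewrite phi_pos_lin; exact: is_entry_lin hb1 hb2.
rewrite /pos_part linear_ext_path; case: and3P => [[/eqP sp /eqP tp p0]|_]; last first.
  by exists 0; rewrite linear0; apply: is_entry0.
have [|q [sq tq cq]] := path_lift sp tp; first by rewrite p0.
by exists (of_path K q); rewrite -sq -tq -cq; apply: is_entry_path.
Qed.

Lemma is_entry_idem x y : tag x = tag y -> (level x <= level y)%N ->
  exists b, is_entry b x y (e (tag x)).
Proof.
move=> xy lxy.
have [||q [sq tq cq]] := @path_lift x y (trivial_path (Q := Q) (tag x)) erefl.
- exact: xy.
- by rewrite lxy orbT.
exists (of_path K q).
have -> : e (tag x) = phi (of_path K (collapse q)) by rewrite cq -phi_vertex.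
by rewrite -sq -tq; apply: is_entry_path.
Qed.

(** Below the diagonal of a diagonal block the trivial path cannot be lifted;
    there r is radical, so its trivial coefficient is 0. *)
Lemma is_entry_exists (phi_surj : forall r : R, exists a, phi a = r) x y r :
  r \in block_space e x y -> exists b, is_entry b x y r.
Proof.
move=> hr; have [er re] := block_space_id he hr; have [a ar] := phi_surj r.
have rE : r = e (tag x) * phi a * e (tag y) by rewrite ar er re.
have [b hb1] := is_entry_pos x y a.
have [txy|txy] := eqVneq (tag x) (tag y); last first.
  by exists b; rewrite rE (phi_split_neq phi_vertex a txy).
have rE' : r = triv_coef (tag x) a *: e (tag x) + phi (pos_part (tag x) (tag y) a).
  by rewrite rE -txy phi_split.
have [lxy|lxy] := leqP (level x) (level y).
  have [b' hb2] := is_entry_idem txy lxy.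
  by exists ((triv_coef (tag x) a : K) *: b' + b); rewrite rE'; exact: is_entry_lin hb2 hb1.
exists b; rewrite rE' (triv_coef_rad hb phi_vertex phi_arrow) ?scale0r ?add0r //.
rewrite {2}txy -rE; move: hr; rewrite /block_space -/(level x) -/(level y).
by rewrite ifT ?txy // leqNgt lxy -txy.
Qed.

(** The collapse of the component of b from x to y, an element of KQ. *)
Definition entry_lift x y : KQ' -> KQ :=
  linear_ext (fun p => if (x == psource p) && (y == ptarget p)
                       then of_path K (collapse p) else 0).
HB.instance Definition _ x y := GRing.Linear.on (entry_lift x y).

Lemma phi_lin c (a b : KQ) : phi (c *: a + b) = c *: phi a + phi b.
Proof. exact: linearP. Qed.

Lemma phiM (a b : KQ) : phi (a * b) = phi a * phi b.
Proof. exact: rmorphM. Qed.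

Lemma entry_liftE x y (b : KQ') : phi (entry_lift x y b) = entry x y b.
Proof.
elim/path_alg_ind: b => [|c a b IHa IHb|p]; first by rewrite !linear0.
  have -> : entry_lift x y (c *: a + b) = c *: entry_lift x y a + entry_lift x y b.
    exact: linearP.
  by rewrite phi_lin entry_lin; congr (_ *: _ + _).
rewrite entry_of_path /entry_lift linear_ext_path /entry_path.
by case: ifP => // _; rewrite linear0.
Qed.

Section Relations.
Variables (A : algType K) (vx : block_index n -> A).
Variables (dl : forall i, 'I_(n i).-1 -> A) (bt : arrow Q -> A).
Hypothesis rel : block_relations n_gt0 vx dl bt.
Variable ev : qpath Q' -> A.
Hypothesis ev_trivial : forall x, ev (trivial_path (Q := Q') x) = vx x.
Hypothesis ev_cons : forall (a : arrow Q') q r,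
  psource q = target a -> psource r = source a -> ptarget r = ptarget q ->
  parrows r = a :: parrows q ->
  ev r = match a with inl d => dl (tagged d) | inr b => bt b end * ev q.

Local Notation delta_seg := (delta_seg dl).
Local Notation ext_map := (ext_map n_gt0 vx dl bt).

(** An element of KQ' is recovered from the collapses of its components. *)
Lemma ev_expand (b : KQ') : linear_ext ev b =
  \sum_x \sum_y (triv_coef (tag x) (entry_lift x y b)
                   *: (vx x * delta_seg (tag x) (level x) (level y))
    + delta_seg (tag x) (level x) (n (tag x)).-1 * ext_map (entry_lift x y b)
      * delta_seg (tag y) 0 (level y)).
Proof.
elim/path_alg_ind: b => [|c a b IHa IHb|p].
- rewrite linear0 big1 // => x _; rewrite big1 // => y _.
  by rewrite !linear0 mulr0 mul0r scale0r addr0.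
- have -> : linear_ext ev (c *: a + b) = c *: linear_ext ev a + linear_ext ev b.
    exact: linearP.
  rewrite IHa IHb scaler_sumr -big_split; apply: eq_bigr => x _ /=.
  rewrite scaler_sumr -big_split; apply: eq_bigr => y _ /=.
  have -> : entry_lift x y (c *: a + b) = c *: entry_lift x y a + entry_lift x y b.
    exact: linearP.
  rewrite ext_map_lin triv_coef_lin mulrDr mulrDl -scalerAr -scalerAl scalerDl scalerDr.
  by rewrite scalerA addrACA.
rewrite [LHS]linear_ext_path (@sum_pair1 _ _ _ (psource p) (ptarget p)) => [|x y xy].
  have -> : entry_lift (psource p) (ptarget p) (of_path K p) = of_path K (collapse p).
    by rewrite /entry_lift linear_ext_path !eqxx.
  rewrite ext_map_path triv_coef_path eqxx (ev_collapse rel ev_trivial ev_cons).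
  by case: eqP => _; rewrite ?scale1r ?scale0r.
have -> : entry_lift x y (of_path K p) = 0 by rewrite /entry_lift linear_ext_path xy.
by rewrite !linear0 mulr0 mul0r scale0r addr0.
Qed.

Variable I : A -> Prop.
Hypothesis hI : two_sided_ideal I.

Lemma ext_map_ideal_mull (x a : KQ) :
  (forall i, triv_coef i x = 0) -> I (ext_map x) -> I (ext_map (a * x)).
Proof.
move=> x0 Ix; elim/path_alg_ind: a => [|c a b IHa IHb|p].
- by rewrite mul0r linear0; apply: ideal_zero.
- have -> : (c *: a + b) * x = c *: (a * x) + b * x by rewrite mulrDl scalerAl.
  by rewrite ext_map_lin; apply: (ideal_add hI) => //; apply: ideal_scale.
by rewrite (ext_map_mull rel) x0 scale0r addr0; apply: ideal_mull.
Qed.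

Lemma ext_map_ideal_mulr (x a : KQ) :
  (forall i, triv_coef i x = 0) -> I (ext_map x) -> I (ext_map (x * a)).
Proof.
move=> x0 Ix; elim/path_alg_ind: a => [|c a b IHa IHb|p].
- by rewrite mulr0 linear0; apply: ideal_zero.
- have -> : x * (c *: a + b) = c *: (x * a) + x * b by rewrite mulrDr scalerAr.
  by rewrite ext_map_lin; apply: (ideal_add hI) => //; apply: ideal_scale.
by rewrite (ext_map_mulr rel) x0 scale0r addr0; exact: (ideal_mulr hI _ Ix).
Qed.

(** The elements of Ker phi with extension in I form a two-sided ideal, as their
    trivial coefficients are 0; it contains the generators. *)
Lemma ext_map_ker (S : KQ -> Prop) :
  (forall a, phi a = 0 -> ideal_gen S a) ->
  (forall r, S r -> phi r = 0 /\ I (ext_map r)) ->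
  forall a, phi a = 0 -> I (ext_map a).
Proof.
move=> kerS hS a /kerS ha.
(* The condition phi a = 0 is carried along to control trivial coefficients. *)
apply: (proj2 (ha (fun a => phi a = 0 /\ I (ext_map a)) _ hS)) => {a ha}.
have triv r : phi r = 0 -> forall i, triv_coef i r = 0.
  by move=> r0 i; apply: (ker_triv_coef hb phi_vertex phi_arrow).
split=> [|r s [r0 Ir] [s0 Is]|a r b [r0 Ir]].
- by rewrite !linear0; split=> //; apply: ideal_zero.
- rewrite -[r]scale1r phi_lin ext_map_lin r0 s0 scaler0 addr0 scale1r.
  by split=> //; apply: (ideal_add hI).
have ar0 : phi (a * r) = 0 by rewrite phiM r0 mulr0.
split; first by rewrite phiM ar0 mul0r.
by apply: ext_map_ideal_mulr; [exact: triv | apply: ext_map_ideal_mull; first exact: triv].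
Qed.

Lemma ev_ker (b : KQ') :
  (forall a, phi a = 0 -> I (ext_map a)) -> (forall x y, entry x y b = 0) ->
  I (linear_ext ev b).
Proof.
move=> hker b0; rewrite ev_expand.
apply: (ideal_bigsum hI) => x _; apply: (ideal_bigsum hI) => y _.
have lift0 : phi (entry_lift x y b) = 0 by rewrite entry_liftE b0.
rewrite (ker_triv_coef hb phi_vertex phi_arrow) // scale0r add0r.
by apply: (ideal_mulr hI); apply: (ideal_mull hI); apply: hker.
Qed.

End Relations.
End BlockPresentation.

(** * The relations in the path algebra of the block quiver *)

Section PathAlgebraOfBlockQuiver.
Variables (K : fieldType) (R : falgType K) (m : nat) (e : 'I_m -> R).
Hypothesis he : complete_primitive_orthogonal e.
Variables (n : 'I_m -> nat) (n_gt0 : forall i, (0 < n i)%N).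

Local Notation Q := (alg_quiver he).
Local Notation Q' := (block_quiver he n_gt0).
Local Notation KQ := (path_alg K Q).
Local Notation KQ' := (path_alg K Q').
Local Notation vtx := (@vertex_elt K Q').
Local Notation del := (@delta K R m e he n n_gt0).
Local Notation bet := (@beta K R m e he n n_gt0).

Lemma block_quiver_relations : block_relations n_gt0 vtx del bet.
Proof.
split=> [x y|i j|i j|a|a].
- exact: vertex_mul_vertex.
- by rewrite [LHS]vertex_mul_arrow ifT // -delta_sourceE.
- by rewrite [LHS]arrow_mul_vertex ifT // -delta_targetE.
- by rewrite [LHS]vertex_mul_arrow ifT // -last_indexE.
by rewrite [LHS]arrow_mul_vertex ifT // -first_indexE.
Qed.

Lemma of_path_cons (a : arrow Q') (q r : qpath Q') :
  psource q = target a -> psource r = source a -> ptarget r = ptarget q ->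
  parrows r = a :: parrows q ->
  of_path K r = match a with inl d => del (tagged d) | inr b => bet b end * of_path K q.
Proof.
move=> sq sr _ ar; have pq : ptarget (arrow_path a) = psource q by rewrite sq.
have [r' [rE sr' ar' _]] := of_path_cat K pq.
have -> : r = r' by apply: qpath_eq; rewrite ?sr' ?ar' ?sr ?ar.
by rewrite -[LHS]rE; case: a {sq sr ar pq rE sr' ar'} => [[i j]|b].
Qed.

Lemma full_seg_delta_full i : full_seg n_gt0 vtx del i = delta_full he n_gt0 i.
Proof. exact: full_segE. Qed.

Lemma ext_word_ext_arrows s : ext_word n_gt0 vtx del bet s = ext_arrows n_gt0 s.
Proof.
elim: s => [|a [|b s] IH]; [exact: erefl | exact: erefl |].
apply: (congr2 (fun y z => bet a * y * z)) IH; exact: full_seg_delta_full.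
Qed.

Lemma ext_map_extension (a : KQ) :
  ext_map n_gt0 vtx del bet a = extension_map n_gt0 a.
Proof.
apply: eq_bigr => p _; apply: (congr1 (fun z => _ *: z)); exact: ext_word_ext_arrows.
Qed.

Variables (sigma : 'I_m -> 'I_m) (theta : 'I_m -> qpath Q).

Lemma theta'E i (u v : nat) : (0 < u)%N -> theta' n_gt0 sigma theta i u v =
  delta_seg del i u.-1 (n i).-1 * ext_word n_gt0 vtx del bet (parrows (theta i))
  * delta_seg del (sigma i) 0 v.
Proof.
move=> u0; rewrite /theta'; apply: (congr2 *%R); last by [].
apply: (congr2 *%R); first by apply: eq_bigl => j; rewrite ltn_ord andbT; case: u u0.
by rewrite -ext_map_path ext_map_extension.
Qed.

Lemma theta'_extend i (u l v c : nat) : (0 < u)%N -> (u <= l <= n i)%N -> (c <= v)%N ->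
  theta' n_gt0 sigma theta i u v
    = delta_seg del i u.-1 l.-1 * theta' n_gt0 sigma theta i l c * delta_seg del (sigma i) c v.
Proof.
move=> u0 /andP[ul ln] cv; have l0 := leq_trans u0 ul.
rewrite (theta'E i v u0) (theta'E i c l0).
by apply: delta_seg_sandwich => //;
  [case: u l u0 l0 ul {ln} => [|u] [|l] | case: l l0 ln {ul}; case: (n i)].
Qed.

End PathAlgebraOfBlockQuiver.

(** * The presentation of the staircase factor algebra *)

Section Isomorphism.
Variables (K : fieldType) (R : falgType K) (m : nat) (e : 'I_m -> R).
Hypotheses (he : complete_primitive_orthogonal e) (hb : basic_algebra e).
Variable phi : {lrmorphism path_alg K (alg_quiver he) -> R}.
Hypothesis phi_vertex : forall i : 'I_m, phi (@vertex_elt K (alg_quiver he) i) = e i.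
Hypothesis phi_arrow : forall a : arrow (alg_quiver he),
  phi (arrow_elt K a) \in arrow_space e (source a) (target a).
Hypothesis phi_surj : forall r : R, exists a, phi a = r.
Variables (n : 'I_m -> nat) (n_gt0 : forall i, (0 < n i)%N).

Local Notation Q := (alg_quiver he).
Local Notation Q' := (block_quiver he n_gt0).
Local Notation KQ := (path_alg K Q).
Local Notation KQ' := (path_alg K Q').
Local Notation P := (block_ext he n_gt0 hb).

Lemma block_map_subproof (b : KQ') :
  [ffun xy => entry phi xy.1 xy.2 b] \in block_pred e (n := n).
Proof.
apply/forallP=> x; apply/forallP=> y; rewrite ffunE.
exact: (entry_block hb phi_vertex phi_arrow).
Qed.

Definition block_map (b : KQ') : P := BlockMatrix (block_map_subproof b).

Lemma block_mapE b x y : block_map b (x, y) = entry phi x y b.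
Proof. exact: ffunE. Qed.

Lemma block_map_is_linear : linear block_map.
Proof.
move=> c a b; apply: block_matrix_eq => x y.
by rewrite block_addE block_scaleE 3!block_mapE; apply: entry_lin.
Qed.
HB.instance Definition _ := GRing.isLinear.Build K KQ' P _ block_map block_map_is_linear.

Lemma block_map1 : block_map 1 = 1.
Proof.
apply: block_matrix_eq => x y; rewrite block_mapE (entry1 phi_vertex).
by rewrite [RHS]ffunE.
Qed.

Lemma block_mapM a b : block_map (a * b) = block_map a * block_map b.
Proof.
apply: block_matrix_eq => x y; rewrite block_extM [LHS]block_mapE entryM.
by apply: eq_bigr => z _; rewrite !block_mapE.
Qed.

(** A matrix is lifted entry by entry. *)
Lemma block_map_assemble (I : KQ' -> Prop) (M : P) :
  two_sided_ideal I ->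
  (forall x y, exists b, I b /\ is_entry phi b x y (M (x, y))) ->
  exists b, I b /\ block_map b = M.
Proof.
move=> hI h; pose f x y := projT1 (cid (h x y)).
have fP x y : I (f x y) /\ is_entry phi (f x y) x y (M (x, y)) := projT2 (cid (h x y)).
exists (\sum_x \sum_y f x y); split.
  by apply: (ideal_bigsum hI) => x _; apply: (ideal_bigsum hI) => y _; case: (fP x y).
apply: block_matrix_eq => x y; rewrite block_mapE.
transitivity (\sum_x' \sum_y' entry phi x y (f x' y')).
  by rewrite [LHS]linear_sum; apply: eq_bigr => x' _; apply: linear_sum.
rewrite (@sum_pair1 _ _ _ x y) => [|x' y' xy].
  by rewrite (fP x y).2 !eqxx.
by rewrite (fP x' y').2 [x == _]eq_sym [y == _]eq_sym xy.
Qed.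

Lemma block_map_surj (M : P) : exists b, block_map b = M.
Proof.
suff [b [_ bM]] : exists b, True /\ block_map b = M by exists b.
apply: (@block_map_assemble (fun _ => True)) => // x y.
have [b hb'] := is_entry_exists hb phi_vertex phi_arrow n_gt0 phi_surj (block_mxP M x y).
by exists b.
Qed.

Variables (sigma : {perm 'I_m}) (hsigma : nakayama_permutation e sigma).
Variables (theta : 'I_m -> qpath Q).
Hypothesis theta_path : forall i,
  [/\ psource (theta i) = i, ptarget (theta i) = sigma i & (1 <= plength (theta i))%N].
Hypothesis theta_socle : forall i,
  phi (of_path K (theta i)) != 0 /\
  phi (of_path K (theta i)) \in socle {:R} (right_proj e i).

Lemma theta_corner_socle i z :
  z \in socle (peirce e (sigma i) (sigma i)) (peirce e i (sigma i)) <->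
  exists c : K, z = c *: phi (of_path K (theta i)).
Proof.
have [t0 ts] := theta_socle i; have [si ti _] := theta_path i.
apply: (corner_socleP he hb _ (hsigma i)) => //.
  exact: (split_corner hb phi_vertex phi_arrow phi_surj).
by have /(peirceE he)[_] := phi_path_peirce phi_vertex (theta i); rewrite ti.
Qed.

(** theta'_i(u, v) is the only path from (i, u) to (sigma i, v + 1) that collapses
    to theta_i, with vertices numbered from 1. *)
Lemma theta'_entry i (u v : nat) : (0 < u <= n i)%N -> (v < n (sigma i))%N ->
  is_entry phi (theta' n_gt0 sigma theta i u v) (idx n_gt0 i u.-1)
    (idx n_gt0 (sigma i) v) (phi (of_path K (theta i))).
Proof.
move=> /andP[u0 un] vn; have [si ti lt] := theta_path i.
have un' : (u.-1 < n i)%N by case: u u0 un.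
have t0 : parrows (theta i) != [::] by rewrite -size_eq0 -lt0n.
have [|q [sq tq cq]] := @path_lift _ _ _ _ he n n_gt0 (idx n_gt0 i u.-1)
  (idx n_gt0 (sigma i) v) (theta i) si ti; first by rewrite t0.
suff -> : theta' n_gt0 sigma theta i u v = of_path K q.
  by rewrite -sq -tq -cq; apply: is_entry_path.
rewrite (theta'E n_gt0 sigma theta i v u0).
have rel := block_quiver_relations he n_gt0.
exact: (esym (ev_nontrivial rel (fun _ => erefl) (@of_path_cons _ _ _ _ he n n_gt0)
  sq tq un' vn cq t0)).
Qed.

Lemma extension_map_entry (p : qpath Q) : parrows p != [::] ->
  is_entry phi (extension_map n_gt0 (of_path K p))
    (idx n_gt0 (psource p) (n (psource p)).-1) (idx n_gt0 (ptarget p) 0)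
    (phi (of_path K p)).
Proof.
move=> p0; have ln : ((n (psource p)).-1 < n (psource p))%N by rewrite ltn_predL.
have [|q [sq tq cq]] := @path_lift _ _ _ _ he n n_gt0
  (idx n_gt0 (psource p) (n (psource p)).-1) (idx n_gt0 (ptarget p) 0) p erefl erefl.
  by rewrite p0.
suff -> : extension_map n_gt0 (of_path K p) = of_path K q.
  by rewrite -sq -tq -cq; apply: is_entry_path.
have := ev_nontrivial (block_quiver_relations he n_gt0) (fun _ => erefl)
  (@of_path_cons _ _ _ _ he n n_gt0) sq tq ln (n_gt0 _) cq p0.
rewrite !delta_seg_nil // mul1r mulr1 => ->.
by rewrite -ext_map_extension ext_map_path.
Qed.

(** An extended path runs from the last level of a block to the first level of
    a block, so each pair of blocks has a single nonzero entry. *)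
Lemma entry_extension_map (a : KQ) x y : entry phi x y (extension_map n_gt0 a) =
  if (level x == (n (tag x)).-1) && (level y == 0)%N
  then phi (pos_part (tag x) (tag y) a) else 0.
Proof.
elim/path_alg_ind: a => [|k a b IHa IHb|p].
- have -> : extension_map n_gt0 (0 : KQ) = 0 by rewrite -ext_map_extension linear0.
  by rewrite !linear0 if_same.
- have -> : extension_map n_gt0 (k *: a + b)
      = k *: extension_map n_gt0 a + extension_map n_gt0 b.
    by rewrite -!ext_map_extension ext_map_lin.
  rewrite [LHS]entry_lin [X in _ *: X + _ = _]IHa [X in _ + X = _]IHb [in RHS]phi_pos_lin.
  case: ((level x == _) && _) {IHa IHb}; first exact: erefl.
  by rewrite scaler0 addr0.
have -> : pos_part (tag x) (tag y) (of_path K p)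
    = if [&& psource p == tag x, ptarget p == tag y & parrows p != [::]]
      then of_path K p else 0 by exact: linear_ext_path.
have [p0|p0] := eqVneq (parrows p) [::].
  have -> : extension_map n_gt0 (of_path K p) = 0.
    by rewrite -ext_map_extension ext_map_path p0.
  by rewrite !andbF !linear0 if_same.
rewrite (extension_map_entry p0) !eq_idx ?ltn_predL // !andbT.
rewrite (eq_sym (tag x)) (eq_sym (tag y)).
have [<-|_] := eqVneq (psource p) (tag x); last by rewrite linear0 if_same.
case: (ptarget p == tag y); last by rewrite !andFb andbF linear0 if_same.
by rewrite !andTb.
Qed.

Lemma block_map_extension (a : KQ) : phi a = 0 -> block_map (extension_map n_gt0 a) = 0.
Proof.
move=> a0; apply: block_matrix_eq => x y.
rewrite block_mapE entry_extension_map [RHS]ffunE; case: ifP => // _.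
have [<-|xy] := eqVneq (tag x) (tag y).
  have := phi_split phi_vertex (tag x) a.
  rewrite a0 (ker_triv_coef hb phi_vertex phi_arrow _ a0) scale0r add0r => <-.
  by rewrite mulr0 mul0r.
by rewrite -(phi_split_neq phi_vertex a xy) a0 mulr0 mul0r.
Qed.

Variables (w : nat) (rho : 'I_w -> KQ).
Hypothesis rho_gen : forall a, phi a = 0 <-> ideal_gen (fun r => exists k, r = rho k) a.

Definition relation_gens (z : KQ') : Prop := exists k, z = extension_map n_gt0 (rho k).

Lemma phi_rho k : phi (rho k) = 0.
Proof. by apply/rho_gen => I _; apply; exists k. Qed.

Lemma block_map_ker (b : KQ') : block_map b = 0 -> ideal_gen relation_gens b.
Proof.
move=> b0; have hJ := ideal_gen_ideal relation_gens.
have bE : linear_ext (@of_path K Q') b = b := esym (path_algE b).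
rewrite -bE; apply: (ev_ker hb phi_vertex phi_arrow (block_quiver_relations he n_gt0)
  (fun _ => erefl) (@of_path_cons _ _ _ _ he n n_gt0) hJ) => [a a0|x y]; last first.
  by rewrite -block_mapE b0; apply: ffunE.
apply: (ext_map_ker hb phi_vertex phi_arrow (block_quiver_relations he n_gt0) hJ
  (fun a => (rho_gen a).1) _ a0) => _ [k ->]; split; first exact: phi_rho.
by rewrite ext_map_extension => I _; apply; exists k.
Qed.

Variables (c : 'I_m -> nat -> nat) (u : 'I_m -> nat) (l : 'I_m -> nat -> nat).
Hypothesis hl : run_ends n c u l.

Definition theta_gens (z : KQ') : Prop := exists i j,
  [/\ (1 <= j <= u i)%N, (c i (l i j) <= (n (sigma i)).-1)%N
    & z = theta' n_gt0 sigma theta i (l i j) (c i (l i j))].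

Lemma run_end_bounds i j : (1 <= j <= u i)%N -> (0 < l i j <= n i)%N.
Proof.
case: (hl i) => -[l0 lu] lS _ _ /andP[j0 ju].
have mono j1 j2 : (j1 <= j2)%N -> (j2 <= u i)%N -> (l i j1 <= l i j2)%N.
  move=> /subnK <-; elim: (j2 - j1)%N => [|d IH] //= du.
  by apply: leq_trans (IH (ltnW du)) (ltnW (lS _ du)).
rewrite -lu mono // andbT; case: j j0 ju => // j _ ju.
exact: leq_ltn_trans (leq0n _) (lS _ ju).
Qed.

(** The run containing a is the first one whose last index is at least a. *)
Lemma run_end_of i a : (0 < a <= n i)%N ->
  exists j, [/\ (1 <= j <= u i)%N, (a <= l i j)%N & c i a = c i (l i j)].
Proof.
case: (hl i) => -[l0 lu] lS lc _ /andP[a0 an].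
have exP : exists j, (a <= l i j)%N by exists (u i); rewrite lu.
(* The previous run ends before a, by minimality of j. *)
case: (ex_minnP exP) => j aj min_j.
have j0 : (0 < j)%N by rewrite lt0n; apply: contraL aj => /eqP ->; rewrite l0 -ltnNge.
have ju : (1 <= j <= u i)%N by rewrite j0 min_j // lu.
exists j; split=> //; apply: lc => //; rewrite aj andbT ltnNge.
by apply/negP=> /min_j; rewrite leqNgt ltn_predL j0.
Qed.

(** Only the corners of the staircase are needed as generators: theta'_i(a, b)
    passes through the end of the run of a. *)
Lemma theta'_in_ideal i (a b : nat) : (0 < a <= n i)%N -> (c i a <= b)%N ->
  (b < n (sigma i))%N -> ideal_gen theta_gens (theta' n_gt0 sigma theta i a b).
Proof.
move=> ha cb bn; have hJ := ideal_gen_ideal theta_gens.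
have [j [hj aj caj]] := run_end_of ha; have [a0 _] := andP ha.
have [_ ln] := andP (run_end_bounds hj).
rewrite caj in cb; rewrite (theta'_extend n_gt0 sigma theta (l := l i j) a0 _ cb) ?aj //.
apply: (ideal_mulr hJ); apply: (ideal_mull hJ) => I _; apply; exists i, j; split=> //.
by rewrite -ltnS prednK // (leq_ltn_trans cb).
Qed.

Lemma block_map_theta' i j : (1 <= j <= u i)%N -> (c i (l i j) <= (n (sigma i)).-1)%N ->
  staircase sigma c (block_map (theta' n_gt0 sigma theta i (l i j) (c i (l i j)))).
Proof.
move=> hj cn x y; have hl' := run_end_bounds hj; have [l0 ln] := andP hl'.
have {}cn : (c i (l i j) < n (sigma i))%N by rewrite -(prednK (n_gt0 _)) ltnS.
rewrite block_mapE (theta'_entry hl' cn).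
case: andP => [[/eqP -> /eqP ->]|_]; last exact: mem0v.
rewrite /staircase_space -!/(level _) !level_idx ?prednK // eqxx ltnSn.
by apply/theta_corner_socle; exists 1; rewrite scale1r.
Qed.

(** An entry allowed by the staircase is a multiple of phi(theta_i), that is, of
    the entry of some theta'_i(u, v) with c_iu <= v. *)
Lemma staircase_lift (M : P) : staircase sigma c M ->
  exists b, ideal_gen theta_gens b /\ block_map b = M.
Proof.
move=> hM; have hJ := ideal_gen_ideal theta_gens.
apply: (block_map_assemble hJ) => x y; have := hM x y; rewrite /staircase_space.
case: ifP => [/andP[/eqP ty cxy]|_]; last first.
  rewrite memv0 => /eqP ->; exists 0; split; first exact: ideal_zero.
  exact: is_entry0.
rewrite ty => /theta_corner_socle[k ->].
exists (k *: theta' n_gt0 sigma theta (tag x) (level x).+1 (level y)).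
have xn : (0 < (level x).+1 <= n (tag x))%N := level_lt x.
have yn : (level y < n (sigma (tag x)))%N by rewrite -ty level_lt.
split; first by apply: (ideal_scale hJ); apply: theta'_in_ideal.
apply: is_entry_scale; have := theta'_entry xn yn.
by rewrite [_.+1.-1]/(level x) -ty !idxE.
Qed.

(** Both directions only test generators: the preimage of an ideal is an ideal,
    and so is its image, block_map being onto. *)
Lemma block_map_ideal (b : KQ') :
  ideal_sum (ideal_gen relation_gens) (ideal_gen theta_gens) b
  <-> ideal_gen (fun M : P => staircase sigma c M) (block_map b).
Proof.
have hR := ideal_gen_ideal relation_gens; have hT := ideal_gen_ideal theta_gens.
have hS := ideal_gen_ideal (fun M : P => staircase sigma c M).
have hI := ideal_sum_ideal hR hT.
split=> [[y [z [Ry Tz ->]]]|].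
  have pre : two_sided_ideal
      (fun b : KQ' => ideal_gen (fun M : P => staircase sigma c M) (block_map b)).
    split=> [|y' z' hy hz|a y' b' hy].
    - by rewrite linear0; apply: ideal_zero.
    - by rewrite linearD; apply: (ideal_add hS).
    by rewrite !block_mapM; case: hS => _ _; apply.
  rewrite linearD; apply: (ideal_add hS).
    apply: (Ry _ pre) => _ [k ->].
    by rewrite block_map_extension ?phi_rho //; apply: ideal_zero.
  apply: (Tz _ pre) => _ [i [j [hj cn ->]]] I _; apply; exact: block_map_theta'.
(* The image of the ideal I'. *)
pose J (M : P) := exists b,
  ideal_sum (ideal_gen relation_gens) (ideal_gen theta_gens) b /\ block_map b = M.
have hJ : two_sided_ideal J.
  split=> [|_ _ [y [Iy <-]] [z [Iz <-]]|M _ N [y [Iy <-]]].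
  - by exists 0; split; [apply: ideal_zero | apply: linear0].
  - by exists (y + z); split; [apply: (ideal_add hI) | apply: linearD].
  have [a <-] := block_map_surj M; have [a' <-] := block_map_surj N.
  by exists (a * y * a'); split; [case: hI => _ _; apply | rewrite !block_mapM].
move=> /(_ J hJ)[] => [M /staircase_lift[z [Tz <-]]|b' [Ib' bb']].
  exists z; split=> //; exists 0, z; split=> //; last by rewrite add0r.
  exact: ideal_zero.
rewrite -[b](subrK b'); apply: (ideal_add hI) => //.
exists (b - b'), 0; split; [|exact: ideal_zero|by rewrite addr0].
by apply: block_map_ker; rewrite linearB; apply/eqP; rewrite subr_eq0; apply/eqP/esym.
Qed.

Lemma staircase_quotient_presentation : quotients_isomorphic
  (fun M : P => staircase sigma c M)
  (ideal_sum (ideal_gen relation_gens) (ideal_gen theta_gens)).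
Proof.
apply: (quotients_isomorphic_of_surjection block_map1 block_mapM block_map_surj _ block_map_ideal).
by apply: ideal_sum_ideal; apply: ideal_gen_ideal.
Qed.

End Isomorphism.

Theorem theorem5p2 (K : closedFieldType) (R : falgType K)
    (m : nat) (e : 'I_m -> R)
    (he : complete_primitive_orthogonal e)
    (hbasic : basic_algebra e)
    (hQF : quasi_frobenius R)
    (sigma : {perm 'I_m}) (hsigma : nakayama_permutation e sigma)
    (x : forall i j : 'I_m, 'I_(arrow_num e i j) -> R)
    (hx : forall i j, basis_mod_decomposable (x i j))
    (phi : {lrmorphism path_alg K (alg_quiver he) -> R})
    (phi_vertex : forall i : 'I_m, phi (@vertex_elt K (alg_quiver he) i) = e i)
    (phi_arrow : forall (i j : 'I_m) (t : 'I_(arrow_num e i j)),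
      phi (arrow_elt K (mk_arrow he t)) = x i j t)
    (phi_surj : forall r : R, exists a, phi a = r)
    (w : nat) (rho : 'I_w -> path_alg K (alg_quiver he))
    (rho_basic : forall k, basic_element (rho k))
    (rho_gen : forall a, phi a = 0 <-> ideal_gen (fun r => exists k, r = rho k) a)
    (n : 'I_m -> nat) (n_gt0 : forall i, (0 < n i)%N)
    (c : 'I_m -> nat -> nat)
    (c_bounds : forall i j, (1 <= j <= n i)%N -> (1 <= c i j <= n (sigma i))%N)
    (c_mono : forall i j, (1 <= j < n i)%N -> (c i j <= c i j.+1)%N)
    (theta : 'I_m -> qpath (alg_quiver he))
    (theta_path : forall i,
      [/\ psource (theta i) = i, ptarget (theta i) = sigma i
        & (1 <= plength (theta i))%N])
    (theta_socle : forall i,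
      phi (of_path K (theta i)) != 0 /\
      phi (of_path K (theta i)) \in socle {:R} (right_proj e i))
    (u : 'I_m -> nat) (l : 'I_m -> nat -> nat) (hl : run_ends n c u l) :
  quotients_isomorphic
    (fun M : block_ext he n_gt0 hbasic => staircase sigma c M)
    (ideal_sum
       (ideal_gen (fun z => exists k, z = extension_map n_gt0 (rho k)))
       (ideal_gen (fun z => exists i j,
          [/\ (1 <= j <= u i)%N, (c i (l i j) <= (n (sigma i)).-1)%N
            & z = theta' n_gt0 sigma theta i (l i j) (c i (l i j))]))).
Proof.
have arrow_mem (a : arrow (alg_quiver he)) :
    phi (arrow_elt K a) \in arrow_space e (source a) (target a).
  case: a => [[i j] t]; have -> := phi_arrow i j t.
  by case: (hx i j) => /(_ t).
exact: (staircase_quotient_presentation hbasic phi_vertex arrow_mem phi_surj n_gt0 hsigma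
  theta_path theta_socle rho_gen hl).
Qed.
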